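(* Let $\mathfrak{S}$ be a separable operator system and let $\mathfrak{A}=\mathrm{C}^*(\mathfrak{S})$. Assume that every irreducible $*$-representation of $\mathfrak{A}$ is a boundary representation for $\mathfrak{S}$. Let $\pi:\mathfrak{A}\to B(\mathcal{H})$ be a unital $*$-representation and let $\Pi:\mathfrak{A}\to B(\mathcal{H})$ be a unital completely positive extension of $\pi|_{\mathfrak{S}}$. Then, the pair $((\Pi-\pi)(\mathfrak{A}),\pi(\mathfrak{A}))$ is unperforated if and only if $\Pi=\pi$. In particular, this is satisfied if $(\Pi-\pi)(\mathfrak{A})$ commutes with $\pi(\mathfrak{A})$.
   Context: An operator system is a unital self-adjoint subspace $\mathfrak{S}$ of $B(\mathcal{K})$ for some Hilbert space $\mathcal{K}$; $\mathrm{C}^*(\mathfrak{S})$ is the $\mathrm{C}^*$-algebra it generates. A linear map on an operator system is completely positive if all its matrix amplifications are positive. An irreducible $*$-representation $\sigma:\mathrm{C}^*(\mathfrak{S})\to B(\mathcal{K}_\sigma)$ is a boundary representation for $\mathfrak{S}$ if the only completely positive map $\mathrm{C}^*(\mathfrak{S})\to B(\mathcal{K}_\sigma)$ extending $\sigma|_{\mathfrak{S}}$ is $\sigma$ itself. A pair $(\mathfrak{V},\mathfrak{T})$ of self-adjoint subspaces of a unital $\mathrm{C}^*$-algebra is unperforated if for every pair of self-adjoint elements $a\in\mathfrak{V}$, $b\in\mathfrak{T}$ with $a\le b$, there is a self-adjoint element $b'\in\mathfrak{T}$ such that $\|b'\|\le\|a\|$ and $a\le b'\le b$. (Above, the subspaces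 $(\Pi-\pi)(\mathfrak{A})$ and $\pi(\mathfrak{A})$ both lie in the $\mathrm{C}^*$-algebra $\mathrm{C}^*(\Pi(\mathfrak{A}))\subset B(\mathcal{H})$ generated by $\Pi(\mathfrak{A})$.) Two subspaces commute if every element of one commutes with every element of the other. *)

(* Defs.v *)
From mathcomp Require Import all_boot all_order all_algebra.
From mathcomp Require Import complex.
From mathcomp Require Import all_classical all_reals all_analysis.

Set Implicit Arguments.
Unset Strict Implicit.
Unset Printing Implicit Defensive.

Import Order.TTheory GRing.Theory Num.Theory numFieldNormedType.Exports.

Local Open Scope classical_set_scope.
Local Open Scope ring_scope.
Local Open Scope complex_scope.

(* Complex Hilbert spaces; the inner product is linear in its first argument
   and conjugate-linear in the second. *)
Record hilbertType (R : realType) := Hilbert {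
  hilbert_sort :> completeNormedModType R[i] ;
  hdot : {dot hilbert_sort for Num.conj} ;
  hdot_norm : forall x : hilbert_sort, hdot x x = `|x| ^+ 2 }.

Arguments hdot {R} h.

Section operators.
Context {R : realType}.
Implicit Types H K : hilbertType R.

(* Operators are represented by functions H -> H, whose pointwise vector space
   structure comes from the library; the product is \o and the unit is id. *)
Definition bounded_operators H : set (H -> H) :=
  [set T | linear T /\ continuous T].

Definition opnorm H (T : H -> H) : R :=
  sup [set complex.Re `|T x| | x in [set x : H | `|x| <= 1]].

Definition is_adjoint H (T T' : H -> H) :=
  forall x y, hdot H (T x) y = hdot H x (T' y).

Definition selfadjoint H (T : H -> H) := is_adjoint T T.

(* In the order of R[i], 0 <= z means that z is real and nonnegative. *)
Definition positive_operator H (T : H -> H) :=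
  forall x, 0 <= hdot H (T x) x.

Definition le_operator H (S T : H -> H) := positive_operator (T - S).

Definition is_subspace (V : lmodType R[i]) (M : set V) :=
  M 0 /\ forall (c : R[i]) u v, M u -> M v -> M (c *: u + v).

Definition selfadjoint_set H (V : set (H -> H)) :=
  forall T, V T -> exists2 T', is_adjoint T T' & V T'.

Definition norm_closed H (V : set (H -> H)) :=
  forall T, bounded_operators T ->
    (forall e : R, 0 < e -> exists2 S, V S & opnorm (T - S) < e) -> V T.

Definition norm_separable H (V : set (H -> H)) :=
  exists D : set (H -> H), [/\ countable D, D `<=` V &
    forall T, V T -> forall e : R, 0 < e ->
      exists2 S, D S & opnorm (T - S) < e].

Definition operator_system K (S : set (K -> K)) :=
  [/\ S `<=` @bounded_operators K, is_subspace S, selfadjoint_set S & S id].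

Definition cstar_algebra K (A : set (K -> K)) :=
  [/\ A `<=` @bounded_operators K, is_subspace A, selfadjoint_set A,
      (forall S T, A S -> A T -> A (S \o T)) & norm_closed A].

Definition cstar_generated K (S : set (K -> K)) : set (K -> K) :=
  smallest (@cstar_algebra K) S.

(* Maps defined on a set A of operators are represented by total functions
   whose values outside A are irrelevant. *)
Definition linear_map_on K H (A : set (K -> K)) (f : (K -> K) -> (H -> H)) :=
  (forall T, A T -> bounded_operators (f T)) /\
  (forall (c : R[i]) S T, A S -> A T -> f (c *: S + T) = c *: f S + f T).

Definition star_representation K H (A : set (K -> K))
    (f : (K -> K) -> (H -> H)) :=
  [/\ linear_map_on A f,
      (forall S T, A S -> A T -> f (S \o T) = f S \o f T) &
      (forall T T', A T -> A T' -> is_adjoint T T' ->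
         is_adjoint (f T) (f T'))].

Definition dsum_dot H n (x y : 'I_n -> H) : R[i] :=
  \sum_(i < n) hdot H (x i) (y i).

(* The operator on the n-fold Hilbert sum of H given by an n x n matrix of
   operators on H. *)
Definition mx_operator H n (a : 'I_n -> 'I_n -> (H -> H)) (x : 'I_n -> H)
    : 'I_n -> H :=
  fun i => \sum_(j < n) a i j (x j).

Definition positive_mx H n (a : 'I_n -> 'I_n -> (H -> H)) :=
  forall x : 'I_n -> H, 0 <= dsum_dot (mx_operator a x) x.

Definition completely_positive K H (A : set (K -> K))
    (f : (K -> K) -> (H -> H)) :=
  linear_map_on A f /\
  forall n (a : 'I_n -> 'I_n -> (K -> K)),
    (forall i j, A (a i j)) -> positive_mx a ->
    positive_mx (fun i j => f (a i j)).

(* The second clause excludes the zero representation, which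
   has no proper invariant subspace on a space of dimension at most one. *)
Definition irreducible_representation K H (A : set (K -> K))
    (f : (K -> K) -> (H -> H)) :=
  [/\ star_representation A f,
      (exists2 T, A T & f T <> 0) &
      (forall M : set H, is_subspace M -> closed M ->
         (forall T x, A T -> M x -> M (f T x)) ->
         M = [set 0] \/ M = setT)].

Definition boundary_representation K H (S : set (K -> K))
    (s : (K -> K) -> (H -> H)) :=
  irreducible_representation (cstar_generated S) s /\
  forall f : (K -> K) -> (H -> H),
    completely_positive (cstar_generated S) f ->
    (forall T, S T -> f T = s T) ->
    forall T, cstar_generated S T -> f T = s T.

Definition unperforated H (V T : set (H -> H)) :=
  forall a b, V a -> selfadjoint a -> T b -> selfadjoint b ->
    le_operator a b ->
    exists b', [/\ T b', selfadjoint b', opnorm b' <= opnorm a,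
                   le_operator a b' & le_operator b' b].

Definition commuting_sets H (V T : set (H -> H)) :=
  forall a b, V a -> T b -> a \o b = b \o a.

End operators.

(* Main.v *)
Require Import Defs.
From HB Require Import structures.
From mathcomp Require Import all_boot all_order all_algebra.
From mathcomp Require Import complex ring lra.
From mathcomp Require Import all_classical all_reals all_analysis.

(** If [Pi] and [pi] agree, then [Pi - pi] vanishes and the pair is unperforated
    with [b' = 0]. For the converse, and for commuting pairs, suppose that the
    two maps differ. Since they are linear and preserve adjoints, they differ at
    some self-adjoint element, and up to a sign this gives a nonzero
    self-adjoint operator [a] in the range of [Pi - pi] whose norm [m] is the
    supremum of its numerical range.

    Let [psi] be a state of the bounded operators on [H] whose restriction to
    the range [M] of [pi] is pure. Its GNS representation restricted to [M],
    composed with [pi], is irreducible ([pure_irreducible]), hence a boundary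
    representation. Compressing the operators [Pi T] to the same GNS space gives
    a completely positive map ([compression_completely_positive]) that agrees
    with this representation on the operator system, hence everywhere. Evaluated
    at the cyclic vector, this says that [psi] takes equal values at [Pi T] and
    [pi T] ([pure_state_extension_eq]). So [psi a = 0], and it is enough to find
    such a state with [psi a = m > 0].

    The states of value [m] at [a] restrict on [M] to a compact convex set of
    states, which has an extreme point. This point is pure if it remains extreme
    among all states of [M], for which it suffices that the set be a face, at
    least for decompositions that come from the GNS space.
    - If the pair is unperforated ([unperforated_peaks]): a state of [M] belongs
      to the set as soon as it is at least [m] at every self-adjoint [b] of [M]
      above [a]. Below such a [b] and above [a] there is [b'] in [M] of norm at
      most [m], where the extreme point has value [m]. As no state exceeds [m]
      there, both parts of a decomposition have value [m] at [b'], hence at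
      least [m] at [b].
    - If the pair commutes ([commuting_peaks]): the cyclic vector is killed by
      [m - a], which commutes with [M], so this holds for all vectors of the GNS
      space and their vector states still have value [m] at [a].

    Compact convex sets of functionals are represented by their support
    functionals, which are sublinear. A minimal sublinear functional is linear,
    so Zorn's lemma yields extreme points and extensions together
    ([extreme_functional], [dominated_extension]), without any topology on the
    dual. The GNS space is the space of bounded antilinear functionals on [M],
    which is complete by construction and needs no quotient. *)

Set Implicit Arguments.
Unset Strict Implicit.
Unset Printing Implicit Defensive.

Import Order.TTheory GRing.Theory Num.Theory numFieldNormedType.Exports.

Local Open Scope classical_set_scope.
Local Open Scope ring_scope.
Local Open Scope complex_scope.

Local Notation Re := complex.Re.
Local Notation Im := complex.Im.

(** * The modulus of a complex number *)

Section modulus.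
Context {R : realType}.
Implicit Types (z w : R[i]) (r : R).

Definition cmod z : R := Re `|z|.

Lemma ReD z w : Re (z + w) = Re z + Re w. Proof. by case: z; case: w. Qed.
Lemma ReN z : Re (- z) = - Re z. Proof. by case: z. Qed.
Lemma ReB z w : Re (z - w) = Re z - Re w. Proof. by rewrite ReD ReN. Qed.
Lemma ImD z w : Im (z + w) = Im z + Im w. Proof. by case: z; case: w. Qed.
Lemma ImN z : Im (- z) = - Im z. Proof. by case: z. Qed.
Lemma Re_realM r z : Re (r%:C * z) = r * Re z.
Proof. by case: z => a b /=; rewrite mul0r subr0. Qed.
Lemma Im_realM r z : Im (r%:C * z) = r * Im z.
Proof. by case: z => a b /=; rewrite mul0r addr0. Qed.
Lemma Re_iM z : Re ('i * z) = - Im z.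
Proof. by case: z => a b /=; rewrite mul0r mul1r sub0r. Qed.
Lemma Re_conjC z : Re (Num.conj z) = Re z. Proof. by case: z. Qed.
Lemma Im_conjC z : Im (Num.conj z) = - Im z. Proof. by case: z. Qed.

Lemma conjr r : Num.conj r%:C = r%:C :> R[i].
Proof. by apply/eqP; rewrite eq_complex /= oppr0 !eqxx. Qed.

Lemma conji : Num.conj 'i = - 'i :> R[i].
Proof. by apply/eqP; rewrite eq_complex /= oppr0 !eqxx. Qed.

Lemma conj_mul z w : Num.conj (z * w) = Num.conj z * Num.conj w.
Proof. exact: rmorphM. Qed.
Lemma conj_add z w : Num.conj (z + w) = Num.conj z + Num.conj w.
Proof. exact: rmorphD. Qed.
Lemma conj_sub z w : Num.conj (z - w) = Num.conj z - Num.conj w.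
Proof. exact: rmorphB. Qed.

Lemma eq_ReIm z w : Re z = Re w -> Im z = Im w -> z = w.
Proof. by case: z; case: w => a b c d /= -> ->. Qed.

Lemma ge0_ReIm z : (0 <= z) = (Im z == 0) && (0 <= Re z).
Proof. by rewrite lecE /=. Qed.

Lemma gt0_realC (e : R[i]) : 0 < e -> exists2 r, 0 < r & e = r%:C.
Proof.
by move=> e0; exists (Re e); [move: e0; rewrite ltcE => /andP[]|
  rewrite RRe_real// gtr0_real].
Qed.

Lemma normE_cmod z : `|z| = (cmod z)%:C.
Proof. by rewrite /cmod normc_def. Qed.

Lemma cmod_ge0 z : 0 <= cmod z.
Proof. by rewrite /cmod normc_def /= sqrtr_ge0. Qed.
Hint Resolve cmod_ge0 : core.

Lemma cmodM z w : cmod (z * w) = cmod z * cmod w.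
Proof. by apply: complexI; rewrite rmorphM /= -!normE_cmod normrM. Qed.

Lemma cmodD z w : cmod (z + w) <= cmod z + cmod w.
Proof. by rewrite -lecR rmorphD /= -!normE_cmod ler_normD. Qed.

Lemma cmodN z : cmod (- z) = cmod z.
Proof. by rewrite /cmod normrN. Qed.

Lemma cmod_distC z w : cmod (z - w) = cmod (w - z).
Proof. by rewrite -opprB cmodN. Qed.

Lemma cmod_distD w z v : cmod (z - v) <= cmod (z - w) + cmod (w - v).
Proof. by apply: le_trans (cmodD _ _); rewrite addrA subrK. Qed.

Lemma cmod_conj z : cmod (Num.conj z) = cmod z.
Proof. by rewrite /cmod norm_conjC. Qed.

Lemma cmodr r : cmod r%:C = `|r|.
Proof. by rewrite /cmod normc_def /= expr0n addr0 sqrtr_sqr. Qed.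

Lemma cmod0 : cmod 0 = 0.
Proof. by rewrite /cmod normr0. Qed.

Lemma cmod1 : cmod 1 = 1.
Proof. by rewrite /cmod normr1. Qed.

Lemma cmodi : cmod 'i = 1.
Proof. by rewrite /cmod normc_def /= expr0n expr1n add0r sqrtr1. Qed.

Lemma cmod_sqr z : cmod z ^+ 2 = Re z ^+ 2 + Im z ^+ 2.
Proof. by rewrite /cmod normc_def /= sqr_sqrtr// addr_ge0 ?sqr_ge0. Qed.

Lemma mul_conj z : z * Num.conj z = (cmod z ^+ 2)%:C.
Proof. by rewrite rmorphXn /= -normE_cmod normCK. Qed.

Lemma cmod_eq0 z : cmod z = 0 -> z = 0.
Proof. by move=> z0; apply/eqP; rewrite -normr_eq0 normE_cmod z0. Qed.

Lemma normRe_le_cmod z : `|Re z| <= cmod z.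
Proof.
by rewrite -(@ler_pXn2r _ 2)// ?nnegrE// cmod_sqr real_normK ?num_real// lerDl sqr_ge0.
Qed.

Lemma normIm_le_cmod z : `|Im z| <= cmod z.
Proof.
by rewrite -(@ler_pXn2r _ 2)// ?nnegrE// cmod_sqr real_normK ?num_real// lerDr sqr_ge0.
Qed.

Lemma Re_le_cmod z : Re z <= cmod z.
Proof. exact: le_trans (ler_norm _) (normRe_le_cmod _). Qed.

Lemma cmod_leReIm z : cmod z <= `|Re z| + `|Im z|.
Proof.
rewrite {1}[z]complexE (le_trans (cmodD _ _))// cmodM cmodi mul1r !cmodr//.
Qed.

(** Turns a bound on real parts that is invariant under multiplication by
    unimodular scalars into a bound on moduli. *)
Lemma cmod_rotation z : exists2 c, cmod c = 1 & c * z = (cmod z)%:C.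
Proof.
have [->|z0] := eqVneq z 0; first by exists 1; rewrite ?cmod1// mulr0 cmod0.
have nz : cmod z != 0 by apply: contra_neq z0 => /cmod_eq0.
exists ((cmod z)^-1%:C * Num.conj z).
  by rewrite cmodM cmod_conj cmodr ger0_norm ?invr_ge0// mulVf.
by rewrite -mulrA [_^* * z]mulrC mul_conj -rmorphM expr2 mulKf.
Qed.

Lemma ge0_approx z :
  (forall e, 0 < e -> exists2 w, 0 <= w & cmod (z - w) <= e) -> 0 <= z.
Proof.
move=> h; rewrite ge0_ReIm; apply/andP; split.
  rewrite -normr_le0; apply/ler_addgt0Pr => e /h[w].
  rewrite ge0_ReIm add0r => /andP[/eqP w0 _] zw.
  by apply: le_trans zw; apply: le_trans (normIm_le_cmod _); rewrite ImD ImN w0 subr0.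
rewrite -oppr_le0; apply/ler_addgt0Pr => e /h[w].
rewrite ge0_ReIm add0r => /andP[_ w0] zw.
by have := Re_le_cmod (w - z); rewrite cmod_distC ReB; lra.
Qed.

Lemma eq_approx z w : (forall e, 0 < e -> cmod (z - w) <= e) -> z = w.
Proof.
move=> h; apply/eqP; rewrite -subr_eq0; apply/eqP/cmod_eq0/eqP.
by rewrite eq_le cmod_ge0 andbT; apply/ler_addgt0Pr => e /h; rewrite add0r.
Qed.

(** Common source of the Cauchy-Schwarz inequality and of the estimate for
    almost minimisers of a quadratic functional. *)
Lemma discriminant (a b d : R) : 0 <= d ->
  (forall r, 0 <= a + 2 * r * b + r ^+ 2 * d) -> b ^+ 2 <= a * d.
Proof.
rewrite le_eqVlt => /predU1P[<- h|d0 h].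
  rewrite mulr0 real_exprn_even_le0 ?num_real//=; apply/negPn/negP => b0.
  have := h (- (a + 1) / (2 * b)); rewrite mulr0 addr0.
  have -> : 2 * (- (a + 1) / (2 * b)) * b = - (a + 1) by field; rewrite b0.
  by lra.
have := h (- b / d).
have -> : a + 2 * (- b / d) * b + (- b / d) ^+ 2 * d = (a * d - b ^+ 2) / d.
  by field; rewrite gt_eqF.
by rewrite pmulr_lge0 ?invr_gt0// subr_ge0.
Qed.

End modulus.
#[global] Hint Resolve cmod_ge0 : core.

(** * Positive semidefinite sesquilinear forms *)

Section psd_forms.
Context {R : realType} {V : lmodType R[i]}.
Implicit Types (u v w t : V) (c : R[i]) (r e : R).

(** Only semidefinite: the form that a state defines on an algebra may have a
    kernel. *)
Definition psd_form (B : V -> V -> R[i]) :=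
  [/\ forall c u v w, B (c *: u + v) w = c * B u w + B v w,
      forall u v, B v u = Num.conj (B u v) &
      forall u, 0 <= B u u].

Definition form_norm (B : V -> V -> R[i]) u : R := Num.sqrt (Re (B u u)).

Section theory.
Variables (B : V -> V -> R[i]) (hB : psd_form B).
Local Notation nrm := (form_norm B).

Let linB c u v w : B (c *: u + v) w = c * B u w + B v w.
Proof. by case: hB. Qed.

Lemma psdC u v : B v u = Num.conj (B u v). Proof. by case: hB. Qed.

Lemma psdDl u v w : B (u + v) w = B u w + B v w.
Proof. by rewrite -{1}[u]scale1r linB mul1r. Qed.

Lemma psd0l w : B 0 w = 0.
Proof. by apply: (addrI (B 0 w)); rewrite -psdDl !addr0. Qed.

Lemma psdZl c u w : B (c *: u) w = c * B u w.
Proof. by rewrite -[c *: u]addr0 linB psd0l addr0. Qed.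

Lemma psdNl u w : B (- u) w = - B u w.
Proof. by rewrite -scaleN1r psdZl mulN1r. Qed.

Lemma psdBl u v w : B (u - v) w = B u w - B v w.
Proof. by rewrite psdDl psdNl. Qed.

Lemma psdDr w u v : B w (u + v) = B w u + B w v.
Proof. by rewrite psdC psdDl rmorphD /= -!psdC. Qed.

Lemma psd0r w : B w 0 = 0.
Proof. by rewrite psdC psd0l rmorph0. Qed.

Lemma psdZr c w u : B w (c *: u) = Num.conj c * B w u.
Proof. by rewrite psdC psdZl rmorphM /= -!psdC. Qed.

Lemma psdNr w u : B w (- u) = - B w u.
Proof. by rewrite psdC psdNl rmorphN /= -!psdC. Qed.

Lemma psdBr w u v : B w (u - v) = B w u - B w v.
Proof. by rewrite psdDr psdNr. Qed.

Lemma psd_suml (I : finType) (f : I -> V) w : B (\sum_i f i) w = \sum_i B (f i) w.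
Proof. by apply: (big_morph (B^~ w)); [move=> x y; apply: psdDl|apply: psd0l]. Qed.

Lemma Re_psdC u v : Re (B v u) = Re (B u v).
Proof. by rewrite psdC Re_conjC. Qed.

Lemma psd_ge0 u : 0 <= B u u. Proof. by case: hB. Qed.

Lemma form_norm_ge0 u : 0 <= nrm u. Proof. exact: sqrtr_ge0. Qed.
Hint Resolve form_norm_ge0 : core.

Lemma form_norm_sqr u : nrm u ^+ 2 = Re (B u u).
Proof.
by rewrite sqr_sqrtr//; have := psd_ge0 u; rewrite ge0_ReIm => /andP[].
Qed.

Lemma psdE u : B u u = (nrm u ^+ 2)%:C.
Proof.
apply: eq_ReIm; rewrite form_norm_sqr//=.
by have := psd_ge0 u; rewrite ge0_ReIm => /andP[/eqP].
Qed.

Lemma form_normZ c u : nrm (c *: u) = cmod c * nrm u.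
Proof.
rewrite /form_norm psdZl psdZr mulrA mul_conj Re_realM sqrtrM ?sqr_ge0//.
by rewrite sqrtr_sqr ger0_norm// cmod_ge0.
Qed.

Lemma form_norm0 : nrm 0 = 0.
Proof. by rewrite /form_norm psd0l sqrtr0. Qed.

Lemma form_normN u : nrm (- u) = nrm u.
Proof. by rewrite /form_norm psdNl psdNr opprK. Qed.

Lemma form_norm_distC u v : nrm (u - v) = nrm (v - u).
Proof. by rewrite -opprB form_normN. Qed.

Lemma form_norm_sqrD r u v :
  nrm (u + r%:C *: v) ^+ 2
  = nrm u ^+ 2 + 2 * r * Re (B u v) + r ^+ 2 * nrm v ^+ 2.
Proof.
rewrite !form_norm_sqr psdDl !psdDr !psdZl !psdZr conjr.
rewrite !ReD !Re_realM (Re_psdC u v); ring.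
Qed.

Lemma psd_CauchySchwarz_Re u v : Re (B u v) <= nrm u * nrm v.
Proof.
apply: le_trans (ler_norm _) _.
rewrite -(@ler_pXn2r _ 2)// ?nnegrE ?mulr_ge0// real_normK ?num_real// exprMn.
apply: discriminant; rewrite ?sqr_ge0// => r.
by rewrite -form_norm_sqrD sqr_ge0.
Qed.

Lemma psd_CauchySchwarz u v : cmod (B u v) <= nrm u * nrm v.
Proof.
have [c c1 cE] := cmod_rotation (B u v).
have := psd_CauchySchwarz_Re (c *: u) v.
by rewrite psdZl cE form_normZ c1 mul1r.
Qed.

Lemma form_normD u v : nrm (u + v) <= nrm u + nrm v.
Proof.
rewrite -(@ler_pXn2r _ 2)// ?nnegrE ?addr_ge0//.
have := form_norm_sqrD 1 u v; rewrite scale1r => ->.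
have := psd_CauchySchwarz_Re u v; nra.
Qed.

Lemma form_norm_distD w u v : nrm (u - v) <= nrm (u - w) + nrm (w - v).
Proof. by apply: le_trans (form_normD _ _); rewrite addrA subrK. Qed.

Lemma form_norm_le_dist u v : nrm u <= nrm v + nrm (u - v).
Proof. by apply: le_trans (form_normD _ _); rewrite addrC subrK. Qed.

Lemma form_norm_ub u e : 0 <= e -> Re (B u u) <= e * nrm u -> nrm u <= e.
Proof.
move=> e0; rewrite -form_norm_sqr expr2.
have := form_norm_ge0 u; rewrite le_eqVlt => /predU1P[<-//|u0].
by rewrite ler_pM2r.
Qed.

Definition antilinear_on (M : set V) (f : V -> R[i]) := forall c u v,
  M u -> M v -> f (c *: u + v) = Num.conj c * f u + f v.

Section variational.
Variables (M : set V) (HM : is_subspace M) (f : V -> R[i]) (C : R).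
Hypotheses (fM : antilinear_on M f)
           (fC : forall t, M t -> cmod (f t) <= C * nrm t).

(** Riesz representation in a space that need not be complete: a vector [u] of
    [M] that minimises [nrm u ^+ 2 - 2 * Re (f u)] up to [e ^+ 2] represents [f]
    on [M] up to [e], because moving away from [u] along a line cannot gain more
    than [e ^+ 2]. *)
Lemma variational_approx e : 0 < e ->
  exists2 u, M u & forall t, M t -> cmod (f t - B u t) <= e * nrm t.
Proof.
move=> e0; have [M0 ML] := HM.
have f0 : f 0 = 0.
  by have := fM (-1) M0 M0; rewrite scaler0 addr0 rmorphN1 mulN1r addNr.
pose J u := nrm u ^+ 2 - 2 * Re (f u).
have Jlb : has_inf (J @` M).
  split; first by exists (J 0), 0.
  exists (- C ^+ 2) => _ [u Mu <-]; rewrite /J.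
  have := le_trans (Re_le_cmod _) (fC Mu); have := sqr_ge0 (nrm u - C); nra.
have [_ [u Mu <-] Ju] := inf_adherent (exprn_gt0 2 e0) Jlb.
have Jmin r t : M t -> J u - e ^+ 2 <= J (u + r%:C *: t).
  move=> Mt; rewrite lerBlDr; apply/ltW/(lt_le_trans Ju); rewrite lerD2r.
  by apply: ge_inf; [case: Jlb|exists (u + r%:C *: t) => //; rewrite addrC; apply: ML].
exists u => // t Mt.
have Re_le s : M s -> Re (B u s - f s) <= e * nrm s.
  move=> Ms; apply: le_trans (ler_norm _) _.
  rewrite -(@ler_pXn2r _ 2)// ?nnegrE ?mulr_ge0 ?(ltW e0)//.
  rewrite real_normK ?num_real// exprMn.
  apply: discriminant; rewrite ?sqr_ge0// => r.
  have := Jmin r s Ms; rewrite /J form_norm_sqrD [u + _]addrC fM// conjr.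
  rewrite ReB ReD Re_realM. nra.
have [c c1 cE] := cmod_rotation (B u t - f t).
have Mct : M (Num.conj c *: t).
  by rewrite -[_ *: _]addr0; apply: ML.
have := Re_le _ Mct; rewrite psdZr conjCK -{1}[_ *: t]addr0 fM// conjCK f0.
by rewrite addr0 -mulrBr cE form_normZ cmod_conj c1 mul1r cmod_distC.
Qed.

End variational.
End theory.
End psd_forms.


(** * Completion of a semidefinite space *)

Section complex_limits.
Context {R : realType} {T : Type} (F : set_system T) {FF : ProperFilter F}.
Implicit Types (z : T -> R[i]) (l : R[i]).

Definition complex_lim z l :=
  forall e : R, 0 < e -> \forall x \near F, cmod (z x - l) <= e.

Lemma eq_complex_lim z z' l : (forall x, z x = z' x) ->
  complex_lim z l -> complex_lim z' l.
Proof. by move=> /funext ->. Qed.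

Lemma complex_lim_le z l w (b : R) : complex_lim z l ->
  (\forall x \near F, cmod (z x - w) <= b) -> cmod (l - w) <= b.
Proof.
move=> zl zw; apply/ler_addgt0Pr => e /zl zle.
have [x [xl xw]] := filter_ex (filterI zle zw).
by apply: le_trans (cmod_distD (z x) _ _) _; rewrite cmod_distC addrC lerD.
Qed.

Lemma complex_lim_unique z l l' :
  complex_lim z l -> complex_lim z l' -> l = l'.
Proof. by move=> zl zl'; apply: eq_approx => e /zl'; exact: complex_lim_le. Qed.

Lemma complex_limP z c z' l l' : complex_lim z l -> complex_lim z' l' ->
  complex_lim (fun x => c * z x + z' x) (c * l + l').
Proof.
move=> zl zl' e e0.
have c0 := cmod_ge0 c.
have d0 : 0 < e / (cmod c + 1) by rewrite divr_gt0// ltr_wpDl.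
move: (zl _ d0) (zl' _ d0); apply: filterS2 => x h h'.
have -> : c * z x + z' x - (c * l + l') = c * (z x - l) + (z' x - l') by ring.
apply: le_trans (cmodD _ _) _; rewrite cmodM.
have -> : e = cmod c * (e / (cmod c + 1)) + e / (cmod c + 1).
  by field; rewrite gt_eqF// ltr_wpDl.
by rewrite lerD// ler_wpM2l.
Qed.

Lemma complex_cauchy z :
  (forall e : R, 0 < e -> exists w, \forall x \near F, cmod (z x - w) <= e) ->
  exists l, complex_lim z l.
Proof.
move=> zC.
have part (p : R[i] -> R) : (forall u v, `|p u - p v| <= cmod (u - v)) ->
    exists a, forall e : R, 0 < e -> \forall x \near F, `|p (z x) - a| <= e.
  move=> pC; have : cauchy ((p \o z) @ F).
    apply: cauchy_exP => e e0; have e20 : 0 < e / 2 by rewrite divr_gt0.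
    have [w zw] := zC _ e20; exists (p w).
    apply: filterS zw => x; rewrite /ball/= => xw.
    apply: le_lt_trans (pC _ _) _; rewrite cmod_distC.
    by apply: le_lt_trans xw _; rewrite ltr_pdivrMr// ltr_pMr// ltr1n.
  move=> /R_complete /cvg_ex[a /cvgrPdist_le pa]; exists a => e /pa.
  by apply: filterS => x; rewrite distrC.
have [a Ha] : exists a, forall e : R, 0 < e -> \forall x \near F, `|Re (z x) - a| <= e.
  by apply: part => u v; rewrite -ReB normRe_le_cmod.
have [b Hb] : exists b, forall e : R, 0 < e -> \forall x \near F, `|Im (z x) - b| <= e.
  by apply: part => u v; rewrite -ImN -ImD normIm_le_cmod.
exists (Complex a b) => e e0; have e20 : 0 < e / 2 by rewrite divr_gt0.
move: (Ha _ e20) (Hb _ e20); apply: filterS2 => x xa xb.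
apply: le_trans (cmod_leReIm _) _; rewrite ReB ImD ImN /= (splitr e).
exact: lerD.
Qed.

End complex_limits.

Lemma small_multiple (R : realType) (K e : R) : 0 <= K -> 0 < e ->
  exists d, [/\ 0 < d, d <= 1 & d * K <= e].
Proof.
move=> K0 e0; exists (Num.min 1 (e / (K + 1))).
have K1 : 0 < K + 1 by rewrite ltr_wpDl.
have d0 : 0 < e / (K + 1) by rewrite divr_gt0.
split; rewrite ?lt_min ?ltr01 ?ge_min ?lexx//.
apply: (@le_trans _ _ (e / (K + 1) * K)); first by rewrite ler_wpM2r// ge_min lexx orbT.
by rewrite mulrAC ler_pdivrMr// ler_wpM2l ?(ltW e0)// lerDl.
Qed.

Section subspace_types.
Context {R : realType} {V : lmodType R[i]}.

Section instances.
Variables (M : set V) (HM : is_subspace M).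

Definition subspace_pred of is_subspace M : {pred V} := fun x => `[< M x >].

Lemma subspace_pred_closed : GRing.submod_closed (subspace_pred HM).
Proof.
case: (HM) => M0 ML; split; first exact/asboolP.
by move=> c u v /asboolP Mu /asboolP Mv; apply/asboolP/ML.
Qed.

HB.instance Definition _ :=
  GRing.isSubmodClosed.Build R[i] V (subspace_pred HM) subspace_pred_closed.

Definition subspace_of := {x : V | x \in subspace_pred HM}.
HB.instance Definition _ := Choice.on subspace_of.
HB.instance Definition _ := SubType.on subspace_of.
HB.instance Definition _ := [SubChoice_isSubLmodule of subspace_of by <:].

Lemma subspaceP (x : subspace_of) : M (val x).
Proof. by apply/asboolP; exact: (valP x). Qed.

Lemma subspace_valP (c : R[i]) (x y : subspace_of) :
  val (c *: x + y) = c *: val x + val y.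
Proof. exact: linearP. Qed.
Lemma subspace_valD (x y : subspace_of) : val (x + y) = val x + val y.
Proof. exact: raddfD. Qed.
Lemma subspace_valN (x : subspace_of) : val (- x) = - val x.
Proof. exact: raddfN. Qed.
Lemma subspace_valB (x y : subspace_of) : val (x - y) = val x - val y.
Proof. exact: raddfB. Qed.
Lemma subspace_valZ (c : R[i]) (x : subspace_of) : val (c *: x) = c *: val x.
Proof. exact: linearZ. Qed.

Definition in_subspace x (Mx : M x) : subspace_of := exist _ x (asboolT Mx).

End instances.
End subspace_types.

Section completion.
Context {R : realType} {V : lmodType R[i]} (B : V -> V -> R[i]) (hB : psd_form B).
Local Notation nrm := (form_norm B).
Implicit Types (t u w : V).

Definition form_bounded (f : V -> R[i]) (C : R) := forall t, cmod (f t) <= C * nrm t.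

Definition bounded_antilinear : set (V -> R[i]) :=
  [set f | antilinear_on setT f /\ exists2 C, 0 <= C & form_bounded f C].

Lemma bounded_antilinear_subspace : is_subspace bounded_antilinear.
Proof.
split.
  split=> [c u v _ _|]; first by rewrite /= mulr0 addr0.
  by exists 0 => // t; rewrite cmod0 mul0r.
move=> c f g [fl [C C0 fC]] [gl [D D0 gD]]; split=> [a u v _ _|].
  rewrite !fctE fl// gl//.
  have scE (x : R[i]) : c *: x = c * x by [].
  rewrite !scE; ring.
exists (cmod c * C + D); rewrite ?addr_ge0 ?mulr_ge0 ?cmod_ge0// => t.
rewrite !fctE; apply: le_trans (cmodD _ _) _; rewrite mulrDl lerD//.
have scE (x : R[i]) : c *: x = c * x by [].
by rewrite scE cmodM -mulrA ler_wpM2l ?cmod_ge0.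
Qed.

(** The antidual of the space: a functional [f] stands for the vector whose
    product with each [u] is [f u]. This is the completion of the quotient by
    the kernel of the form, but neither a quotient nor classes of Cauchy
    sequences appear. *)
Definition completion of psd_form B := subspace_of bounded_antilinear_subspace.
HB.instance Definition _ := GRing.Lmodule.on (completion hB).
HB.instance Definition _ := SubType.on (completion hB).
Implicit Types (f g h : completion hB).

Lemma completionP f c u v : val f (c *: u + v) = Num.conj c * val f u + val f v.
Proof. by have [fl _] := subspaceP f; rewrite fl. Qed.

Lemma completion_bound f : exists2 C, 0 <= C & form_bounded (val f) C.
Proof. by have [_] := subspaceP f. Qed.

Lemma completionB f u v : val f (u - v) = val f u - val f v.
Proof. by rewrite addrC -scaleN1r completionP rmorphN1 mulN1r addrC. Qed.

Lemma completionDE f g t : val (f + g) t = val f t + val g t.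
Proof. by rewrite raddfD. Qed.

Lemma completionNE f t : val (- f) t = - val f t.
Proof. by rewrite raddfN. Qed.

Lemma completionZE f c t : val (c *: f) t = c * val f t.
Proof. by rewrite linearZ. Qed.

(** Says that [f] is at distance at most [e] from the vector given by [w], in
    terms that make sense before the norm of the completion is available. *)
Definition dual_close f w (e : R) := forall t, cmod (val f t - B w t) <= e * nrm t.

Lemma dual_close_ex f e : 0 < e -> exists w, dual_close f w e.
Proof.
move=> e0; have [fl [C _ fC]] := subspaceP f.
have sT : is_subspace (@setT V) by [].
have [w _ wP] := variational_approx hB sT fl (fun t _ => fC t) e0.
by exists w => t; apply: wP.
Qed.

Lemma approximant_ex f (n : nat) : exists w, dual_close f w (n.+1%:R^-1).
Proof. by apply: dual_close_ex; rewrite invr_gt0. Qed.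

Definition approximant f n : V := projT1 (cid (approximant_ex f n)).

Lemma approximantP f n : dual_close f (approximant f n) (n.+1%:R^-1).
Proof. by rewrite /approximant; case: cid. Qed.

Lemma dual_close_dist f u w d e : 0 <= d -> 0 <= e ->
  dual_close f u d -> dual_close f w e -> nrm (u - w) <= d + e.
Proof.
move=> d0 e0 fu fw; apply: (form_norm_ub hB (addr_ge0 d0 e0)).
apply: le_trans (Re_le_cmod _) _; rewrite (psdBl hB).
apply: le_trans (cmod_distD (val f (u - w)) _ _) _.
by rewrite mulrDl lerD// cmod_distC.
Qed.

Lemma dual_close_norm f w C e : form_bounded (val f) C -> 0 <= C -> 0 <= e ->
  dual_close f w e -> nrm w <= C + e.
Proof.
move=> fC C0 e0 fw; apply: (form_norm_ub hB (addr_ge0 C0 e0)).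
apply: le_trans (Re_le_cmod _) _.
rewrite -[B w w]subr0; apply: le_trans (cmod_distD (val f w) _ _) _.
by rewrite subr0 addrC mulrDl lerD// cmod_distC.
Qed.

Lemma approximant_lim f g :
  exists l, complex_lim \oo (fun n => val f (approximant g n)) l.
Proof.
have [C C0 fC] := completion_bound f.
apply: complex_cauchy => e e0.
have C1 : 0 < C + 1 by rewrite ltr_wpDl.
have d0 : 0 < e / (C + 1) / 2 by rewrite !divr_gt0.
have [w gw] := dual_close_ex g d0.
exists (val f w); near=> n.
rewrite -completionB; apply: le_trans (fC _) _.
have n0 : 0 <= n.+1%:R^-1 :> R by rewrite invr_ge0.
have := dual_close_dist n0 (ltW d0) (approximantP g n) gw.
have nd : n.+1%:R^-1 <= e / (C + 1) / 2.
  by apply/ltW; near: n; exact: near_infty_natSinv_lt (PosNum d0).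
move=> h; apply: (@le_trans _ _ (C * (e / (C + 1)))).
  by apply: ler_wpM2l => //; apply: le_trans h _; rewrite [leRHS]splitr lerD.
by rewrite mulrA ler_pdivrMr// mulrC ler_wpM2l ?(ltW e0)// lerDl.
Unshelve. all: by end_near. Qed.

(** Approximating only the second argument makes the product linear in the
    first one at once; its symmetry is what has to be proved. *)
Definition completion_dot f g : R[i] := projT1 (cid (approximant_lim f g)).

Lemma completion_dot_lim f g :
  complex_lim \oo (fun n => val f (approximant g n)) (completion_dot f g).
Proof. by rewrite /completion_dot; case: cid. Qed.

Lemma completion_dot_close f g w C e : form_bounded (val f) C -> 0 <= C -> 0 <= e ->
  dual_close g w e -> cmod (completion_dot f g - val f w) <= C * e.
Proof.
move=> fC C0 e0 gw; apply/ler_addgt0Pr => d d0.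
have C1 : 0 < C + 1 by rewrite ltr_wpDl.
have dC0 : 0 < d / (C + 1) by rewrite divr_gt0.
apply: complex_lim_le (completion_dot_lim f g) _; near=> n.
rewrite -completionB; apply: le_trans (fC _) _.
have n0 : 0 <= n.+1%:R^-1 :> R by rewrite invr_ge0.
have h := dual_close_dist n0 e0 (approximantP g n) gw.
have nd : n.+1%:R^-1 <= d / (C + 1).
  by apply/ltW; near: n; exact: near_infty_natSinv_lt (PosNum dC0).
apply: (@le_trans _ _ (C * (d / (C + 1) + e))).
  by apply: ler_wpM2l => //; apply: le_trans h _; rewrite lerD2r.
rewrite mulrDr addrC lerD2l mulrA ler_pdivrMr// mulrC.
by rewrite ler_wpM2l ?(ltW d0)// lerDl.
Unshelve. all: by end_near. Qed.

(** Approximating both arguments: this is where the symmetry and the positivity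
    of the form are inherited by the completion. *)
Lemma completion_dot_form f g u w C D e :
  form_bounded (val f) C -> form_bounded (val g) D -> 0 <= C -> 0 <= D -> 0 <= e ->
  dual_close f u e -> dual_close g w e ->
  cmod (completion_dot f g - B u w) <= e * (C + D + e).
Proof.
move=> fC gD C0 D0 e0 fu gw.
apply: le_trans (cmod_distD (val f w) _ _) _.
have h1 := completion_dot_close fC C0 e0 gw.
have h2 := fu w.
have := ler_wpM2l e0 (dual_close_norm gD D0 e0 gw).
lra.
Qed.

Lemma completion_dot_approx f g e : 0 < e -> exists u w,
  cmod (completion_dot f g - B u w) <= e /\ cmod (completion_dot g f - B w u) <= e /\
  (f = g -> u = w).
Proof.
move=> e0; have [C C0 fC] := completion_bound f.
have [D D0 gD] := completion_bound g.
have K0 : 0 <= C + D + 1 by rewrite !addr_ge0.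
have [d [d0 d1 de]] := small_multiple K0 e0.
have [u fu] := dual_close_ex f d0.
have [w [gw uw]] : exists w, dual_close g w d /\ (f = g -> u = w).
  case: (pselect (f = g)) => [<-|fg]; first by exists u.
  by have [w gw] := dual_close_ex g d0; exists w.
have le x y : 0 <= x -> 0 <= y -> x + y = C + D -> d * (x + y + d) <= e.
  by move=> x0 y0 ->; apply: le_trans de; rewrite ler_pM2l// lerD2l.
exists u, w; split; [|split] => //.
  by apply: le_trans (completion_dot_form fC gD _ _ (ltW d0) fu gw) (le _ _ _ _ _).
apply: le_trans (completion_dot_form gD fC _ _ (ltW d0) gw fu) (le _ _ _ _ _) => //.
exact: addrC.
Qed.

Lemma completion_dot_psd : psd_form completion_dot.
Proof.
split=> [c f g h|f g|f].
- apply: complex_lim_unique (completion_dot_lim _ _) _.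
  apply: (eq_complex_lim _ (complex_limP c (completion_dot_lim f h) (completion_dot_lim g h))) => n.
  by rewrite completionDE completionZE.
- apply: eq_approx => e e0; have e20 : 0 < e / 2 by rewrite divr_gt0.
  have [u [w [h1 [h2 _]]]] := completion_dot_approx f g e20.
  apply: le_trans (cmod_distD (B w u) _ _) _; rewrite (splitr e) lerD//.
  by rewrite (psdC hB u w) -rmorphB cmod_conj cmod_distC.
- apply: ge0_approx => e e0; have [u [w [h1 [h2 uw]]]] := completion_dot_approx f f e0.
  by exists (B u w) => //; rewrite uw// (psd_ge0 hB).
Qed.

Lemma form_antilinear w : bounded_antilinear (B w).
Proof.
split=> [c u v _ _|]; first by rewrite (psdDr hB) (psdZr hB).
exists (nrm w); first exact: form_norm_ge0.
by move=> t; exact: (psd_CauchySchwarz hB).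
Qed.

Definition to_completion w : completion hB := in_subspace _ (form_antilinear w).

Lemma to_completionE w t : val (to_completion w) t = B w t. Proof. by []. Qed.

Lemma completion_dotr f w : completion_dot f (to_completion w) = val f w.
Proof.
have [C C0 fC] := completion_bound f.
apply: eq_approx => e /ltW e0; rewrite -[e]addr0.
have := @completion_dot_close f (to_completion w) w C 0 fC C0 (lexx _).
rewrite mulr0 addr0 => h; apply: le_trans e0; apply: h => t.
by rewrite to_completionE subrr cmod0 mul0r.
Qed.

Lemma completion_norm_to w : form_norm completion_dot (to_completion w) = nrm w.
Proof. by rewrite /form_norm completion_dotr. Qed.

Lemma completion_eqP f g : (forall t, val f t = val g t) -> f = g.
Proof. by move=> fg; apply/val_inj/funext. Qed.

Lemma completion_norm_le f e : 0 <= e -> form_bounded (val f) e ->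
  form_norm completion_dot f <= e.
Proof.
move=> e0 fe; rewrite -(@ler_pXn2r _ 2)// ?nnegrE ?form_norm_ge0//.
rewrite (form_norm_sqr completion_dot_psd); apply: le_trans (Re_le_cmod _) _.
apply/ler_addgt0Pr => d d0.
have K0 : 0 <= e + e + 1 by rewrite !addr_ge0.
have [c [c0 c1 ce]] := small_multiple K0 d0.
have [w fw] := dual_close_ex f c0.
have h1 := completion_dot_close fe e0 (ltW c0) fw.
have h2 := fe w.
have h3 := dual_close_norm fe e0 (ltW c0) fw.
rewrite -[completion_dot _ _]subr0.
apply: le_trans (cmod_distD (val f w) _ _) _; rewrite subr0.
nra.
Qed.

Lemma completion_bounded_norm f : form_bounded (val f) (form_norm completion_dot f).
Proof.
move=> t; rewrite -completion_dotr -completion_norm_to.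
exact: (psd_CauchySchwarz completion_dot_psd).
Qed.

Lemma completion_dense f e : 0 < e ->
  exists w, form_norm completion_dot (f - to_completion w) <= e.
Proof.
move=> e0; have [w fw] := dual_close_ex f e0; exists w.
by apply: completion_norm_le (ltW e0) _ => t; rewrite completionDE completionNE; exact: fw.
Qed.

Definition completion_norm f : R[i] := (form_norm completion_dot f)%:C.

Let ler_normD f g : completion_norm (f + g) <= completion_norm f + completion_norm g.
Proof. by rewrite -rmorphD/= lecR (form_normD completion_dot_psd). Qed.

Let normrZ c f : completion_norm (c *: f) = `|c| * completion_norm f.
Proof. by rewrite /completion_norm (form_normZ completion_dot_psd) rmorphM/= -normE_cmod. Qed.

Let normr0_eq0 f : completion_norm f = 0 -> f = 0.
Proof.
move=> [f0]; apply: completion_eqP => t; apply: cmod_eq0; apply/eqP.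
by rewrite eq_le cmod_ge0 andbT; have := completion_bounded_norm f t; rewrite f0 mul0r.
Qed.

HB.instance Definition _ := Lmodule_isNormed.Build R[i] (completion hB)
  ler_normD normrZ normr0_eq0.

Lemma completion_normE f : `|f| = (form_norm completion_dot f)%:C.
Proof. by []. Qed.

(** The pointwise limit of a Cauchy filter is again bounded and antilinear, and
    the bounds pass to the limit. *)
Lemma completion_complete (F : set_system (completion hB)) :
  ProperFilter F -> cauchy F -> cvg F.
Proof.
move=> FF FC.
have nearF (e : R) : 0 < e -> exists f : completion hB,
    \forall g \near F, form_norm completion_dot (g - f) <= e.
  move=> e0; move/cauchyP : FC; rewrite /cauchy_ex => /(_ e%:C).
  rewrite ltcR => /(_ e0)[f Ff]; exists f; apply: filterS Ff => g.
  rewrite -ball_normE /= distrC completion_normE ltcR; exact: ltW.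
have pt t : exists l, complex_lim F (fun g : completion hB => val g t) l.
  apply: complex_cauchy => e e0.
  have t1 : 0 < nrm t + 1 by rewrite ltr_wpDl// form_norm_ge0.
  have d0 : 0 < e / (nrm t + 1) by rewrite divr_gt0.
  have [f Ff] := nearF _ d0; exists (val f t); apply: filterS Ff => g gf.
  have := completion_bounded_norm (g - f) t; rewrite completionDE completionNE => h.
  apply: le_trans h _; apply: (@le_trans _ _ (e / (nrm t + 1) * nrm t)).
    by rewrite ler_wpM2r// form_norm_ge0.
  by rewrite mulrAC ler_pdivrMr// ler_wpM2l ?(ltW e0)// lerDl.
pose l t := projT1 (cid (pt t)).
have lP t : complex_lim F (fun g : completion hB => val g t) (l t).
  by rewrite /l; case: cid.
have lclose (f : completion hB) e : (\forall g \near F, form_norm completion_dot (g - f) <= e) ->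
    forall t, cmod (l t - val f t) <= e * nrm t.
  move=> Ff t; apply: complex_lim_le (lP t) _; apply: filterS Ff => g gf.
  have := completion_bounded_norm (g - f) t; rewrite completionDE completionNE => h.
  by apply: le_trans h _; rewrite ler_wpM2r// form_norm_ge0.
have lb : bounded_antilinear l.
  split=> [c u v _ _|].
    apply: complex_lim_unique (lP _) _.
    apply: (eq_complex_lim _ (complex_limP (Num.conj c) (lP u) (lP v))) => g.
    by rewrite completionP.
  have [f Ff] := nearF _ ltr01; have [C C0 fC] := completion_bound f.
  exists (1 + C); first by rewrite addr_ge0.
  move=> t; rewrite -[l t]subr0; apply: le_trans (cmod_distD (val f t) _ _) _.
  by rewrite subr0 mulrDl lerD// lclose.
apply/cvg_ex; exists (in_subspace _ lb); apply/cvgrPdist_le => e.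
move=> /gt0_realC[a a0 ->]; have a20 : 0 < a / 2 by rewrite divr_gt0.
have [f Ff] := nearF _ a20; apply: filterS (Ff) => g gf.
rewrite completion_normE lecR.
apply: le_trans (form_norm_distD completion_dot_psd f _ _) _.
rewrite (splitr a); apply: lerD.
  apply: completion_norm_le (ltW a20) _ => t.
  rewrite completionDE completionNE; exact: lclose.
by rewrite (form_norm_distC completion_dot_psd).
Qed.

HB.instance Definition _ := Uniform_isComplete.Build (completion hB) completion_complete.

End completion.

Section hilbert_of_form.
Context {R : realType} {V : lmodType R[i]} (B : V -> V -> R[i]) (hB : psd_form B).
Let L := completion hB.

Definition completion_form : L -> L -> R[i] := @completion_dot R V B hB.

Let dotP : psd_form completion_form := completion_dot_psd hB.

Let dot_bilinear : bilinear_for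
  (GRing.Scale.Law.clone _ _ ( *%R ) _) (GRing.Scale.Law.clone _ _ (Num.conj \; *%R ) _)
  (completion_form : L -> L -> R[i]).
Proof.
split=> [u c x y|u c x y].
  by rewrite (psdDl dotP) (psdZl dotP).
by rewrite (psdDr dotP) (psdZr dotP).
Qed.
HB.instance Definition _ := bilinear_isBilinear.Build R[i] L L R[i]
  _ _ completion_form dot_bilinear.

Let dot_herm (x y : L) : completion_form x y = (-1) ^+ false * Num.conj (completion_form y x).
Proof. by rewrite expr0 mul1r; exact: (psdC dotP). Qed.
HB.instance Definition _ := isHermitianSesquilinear.Build R[i] L false Num.conj
  completion_form dot_herm.

Let dot_gt0 (x : L) : x != 0 -> 0 < completion_form x x.
Proof.
move=> x0; rewrite lt_def (psd_ge0 dotP) andbT.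
apply: contra x0; rewrite (psdE dotP) => /eqP[/eqP]; rewrite sqrf_eq0 => /eqP nx.
by rewrite -normr_eq0 completion_normE nx.
Qed.
HB.instance Definition _ := isDotProduct.Build R[i] L completion_form dot_gt0.

Let dot_norm (x : L) : completion_form x x = `|x| ^+ 2.
Proof. by rewrite completion_normE (psdE dotP) rmorphXn. Qed.

Definition completion_hilbert : hilbertType R := @Hilbert R L completion_form dot_norm.

End hilbert_of_form.



(** * Bounded operators on a Hilbert space *)

Section hilbert.
Context {R : realType} {X : hilbertType R}.
Implicit Types (x y z : X) (e : R).
Local Notation nrm := (form_norm (hdot X)).

Lemma hdot_psd : psd_form (hdot X).
Proof.
split=> [c u v w|u v|u]; first by rewrite linearDl/= linearZl_LR.
  by rewrite hermC expr0 mul1r.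
by rewrite hdot_norm exprn_ge0.
Qed.

Lemma hilbert_normE x : `|x| = (nrm x)%:C.
Proof.
apply/eqP; rewrite -(@eqrXn2 _ 2)//; last by rewrite ler0c form_norm_ge0.
by rewrite -hdot_norm (psdE hdot_psd) rmorphXn.
Qed.

Lemma hdotI x y : (forall t, hdot X x t = hdot X y t) -> x = y.
Proof.
move=> xy; apply/eqP; rewrite -subr_eq0 -normr_eq0 hilbert_normE.
by rewrite /form_norm (psdBl hdot_psd) xy subrr sqrtr0.
Qed.

Lemma hilbert_norm_eq0 x : nrm x <= 0 -> x = 0.
Proof.
move=> x0; apply/eqP; rewrite -normr_eq0 hilbert_normE.
by rewrite (@le_anti _ _ (nrm x) 0)// x0 form_norm_ge0.
Qed.

Lemma hilbert_nbhsP (A : set X) x : nbhs x A <->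
  exists2 e : R, 0 < e & forall y, nrm (x - y) < e -> A y.
Proof.
split=> [/nbhs_ballP[e /= /gt0_realC[a a0 eE] eA]|[e e0 eA]].
  exists a => // y xy.
  by apply: eA; rewrite -ball_normE /= eE hilbert_normE ltcR.
apply/nbhs_ballP; exists e%:C; rewrite /= ?ltcR// => y.
by rewrite -ball_normE /= hilbert_normE ltcR; apply: eA.
Qed.

Lemma hilbert_closed (M : set X) x : closed M ->
  (forall e : R, 0 < e -> exists2 y, M y & nrm (x - y) < e) -> M x.
Proof.
move=> clM xM; apply: clM => A /hilbert_nbhsP[e /xM[y My xy] eA].
by exists y; split => //; exact: eA.
Qed.

Lemma hilbert_complete (u : nat -> X) :
  (forall e : R, 0 < e -> exists w, \forall n \near \oo, nrm (u n - w) <= e) ->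
  exists l, forall e : R, 0 < e -> \forall n \near \oo, nrm (u n - l) <= e.
Proof.
move=> uC; have : cauchy (u @ \oo).
  apply: cauchy_exP => e /gt0_realC[a a0 ->]; have a20 : 0 < a / 2 by rewrite divr_gt0.
  have [w uw] := uC _ a20; exists w; apply: filterS uw => n nw.
  rewrite -ball_normE /= hilbert_normE ltcR (form_norm_distC hdot_psd).
  by apply: le_lt_trans nw _; rewrite ltr_pdivrMr// ltr_pMr// ltr1n.
move=> /cauchy_cvg /cvg_ex[l /cvgrPdist_le ul]; exists l => e e0.
have := ul e%:C; rewrite ltcR => /(_ e0); apply: filterS => n.
by rewrite hilbert_normE lecR (form_norm_distC hdot_psd).
Qed.

(** The vectors provided by [variational_approx] for errors that tend to zero
    form a Cauchy sequence in [M]. *)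
Lemma riesz (M : set X) (f : X -> R[i]) (C : R) : is_subspace M -> closed M ->
  antilinear_on M f -> (forall t, M t -> cmod (f t) <= C * nrm t) ->
  exists2 m, M m & forall t, M t -> f t = hdot X m t.
Proof.
move=> HM clM fl fC; have [M0 ML] := HM.
have n0 n : 0 < n.+1%:R^-1 :> R by rewrite invr_gt0.
have h n := variational_approx hdot_psd HM fl fC (n0 n).
pose u n := projT1 (cid2 (h n)).
have Mu n : M (u n) by rewrite /u; case: cid2.
have uf n t : M t -> cmod (f t - hdot X (u n) t) <= n.+1%:R^-1 * nrm t.
  by rewrite /u; case: cid2 => /= m _; apply.
have MB s t : M s -> M t -> M (s - t).
  by move=> Ms Mt; rewrite addrC -scaleN1r; exact: ML.
have [|m um] := @hilbert_complete u.
  move=> e e0; have e20 : 0 < e / 2 by rewrite divr_gt0.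
  have small : \forall n \near \oo, n.+1%:R^-1 <= e / 2.
    by near=> n; apply/ltW; near: n; exact: near_infty_natSinv_lt (PosNum e20).
  have [N _ NP] := small; exists (u N); exists N => // n /= Nn.
  apply: (form_norm_ub hdot_psd (ltW e0)).
  apply: le_trans (Re_le_cmod _) _; rewrite (psdBl hdot_psd).
  have Md := MB _ _ (Mu n) (Mu N).
  apply: le_trans (cmod_distD (f (u n - u N)) _ _) _.
  rewrite (splitr e) mulrDl; apply: lerD.
    rewrite cmod_distC; apply: le_trans (uf _ _ Md) _.
    by rewrite ler_wpM2r ?form_norm_ge0//; exact: NP.
  apply: le_trans (uf _ _ Md) _.
  by rewrite ler_wpM2r ?form_norm_ge0//; apply: NP => /=.
exists m => [|t Mt].
  apply: hilbert_closed clM _ => e e0; have e20 : 0 < e / 2 by rewrite divr_gt0.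
  have [n nm] := filter_ex (um _ e20); exists (u n) => //.
  rewrite (form_norm_distC hdot_psd); apply: le_lt_trans nm _.
  by rewrite ltr_pdivrMr// ltr_pMr// ltr1n.
apply: eq_approx => e e0.
have [d [d0 _ de]] := @small_multiple _ (2 * nrm t) e (mulr_ge0 (ler0n _ 2) (form_norm_ge0 _ _)) e0.
have small : \forall n \near \oo, n.+1%:R^-1 <= d.
  by near=> n; apply/ltW; near: n; exact: near_infty_natSinv_lt (PosNum d0).
have [n [nd nm]] := filter_ex (filterI small (um _ d0)).
apply: le_trans (cmod_distD (hdot X (u n) t) _ _) _.
apply: le_trans de; rewrite mulr_natl mulr2n mulrDr; apply: lerD.
  by apply: le_trans (uf _ _ Mt) _; rewrite ler_wpM2r ?form_norm_ge0.
rewrite -(psdBl hdot_psd); apply: le_trans (psd_CauchySchwarz hdot_psd _ _) _.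
by rewrite ler_wpM2r ?form_norm_ge0.
Unshelve. all: by end_near. Qed.

Lemma orthogonal_projection (M : set X) x : is_subspace M -> closed M ->
  exists2 m, M m & forall t, M t -> hdot X (x - m) t = 0.
Proof.
move=> HM clM; have [||m Mm mP] := @riesz M (hdot X x) (nrm x) HM clM.
- by move=> c u v _ _; rewrite (psdDr hdot_psd) (psdZr hdot_psd).
- by move=> t _; exact: (psd_CauchySchwarz hdot_psd).
by exists m => // t Mt; rewrite (psdBl hdot_psd) mP// subrr.
Qed.

Implicit Types (S T : X -> X).

Definition operator_bound T (C : R) := forall x, nrm (T x) <= C * nrm x.

Lemma bounded_operatorsP T : bounded_operators T <->
  (forall c x y, T (c *: x + y) = c *: T x + T y) /\
  (exists2 C, 0 <= C & operator_bound T C).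
Proof.
split=> [[Tl Tc]|[Tl [C C0 TC]]].
  split=> //.
  have T0 : T 0 = 0.
    by apply: (addrI (1 *: T 0)); rewrite -Tl scale1r !addr0 scale1r.
  have TZ c x : T (c *: x) = c *: T x by rewrite -[c *: x]addr0 Tl T0 addr0.
  have /hilbert_nbhsP[d d0 dP] : nbhs (0 : X) (T @^-1` [set y | nrm y < 1]).
    apply: Tc; rewrite T0; apply/hilbert_nbhsP; exists 1 => // y.
    by rewrite sub0r (form_normN hdot_psd).
  exists (2 / d); first by rewrite divr_ge0// ltW.
  move=> x; have := form_norm_ge0 (hdot X) x.
  rewrite le_eqVlt => /predU1P[x0|x0].
    suff -> : x = 0 by rewrite T0 (form_norm0 hdot_psd) mulr0.
    by apply/eqP; rewrite -normr_eq0 hilbert_normE -x0.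
  pose r := d / 2 / nrm x.
  have r0 : 0 < r by rewrite !divr_gt0.
  have := dP (r%:C *: x); rewrite sub0r (form_normN hdot_psd) /= TZ.
  rewrite !(form_normZ hdot_psd) !cmodr gtr0_norm// {1}/r divfK ?gt_eqF//.
  rewrite ltr_pdivrMr// ltr_pMr// ltr1n => /(_ isT) h.
  have -> : 2 / d * nrm x = r^-1 by rewrite /r !invfM !invrK; ring.
  by rewrite -[_^-1]mul1r ler_pdivlMr// mulrC ltW.
split=> // x; apply/cvgrPdist_le => e /gt0_realC[a a0 ->].
have C1 : 0 < C + 1 by rewrite ltr_wpDl.
apply/hilbert_nbhsP; exists (a / (C + 1)); first by rewrite divr_gt0.
move=> y xy; rewrite hilbert_normE lecR.
have -> : T x - T y = T (x - y) by rewrite addrC -scaleN1r -Tl scaleN1r addrC.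
apply: le_trans (TC _) _; apply: (@le_trans _ _ (C * (a / (C + 1)))).
  by rewrite ler_wpM2l// ltW.
by rewrite mulrA ler_pdivrMr// mulrC ler_wpM2l ?(ltW a0)// lerDl.
Qed.

End hilbert.

Section operators.
Context {R : realType} {X : hilbertType R}.
Implicit Types (x y z : X) (e : R) (S T U : X -> X).
Local Notation nrm := (form_norm (hdot X)).
Local Notation dotP := (@hdot_psd R X).
Local Notation bo := (@bounded_operators R X).

Lemma opDE S T x : (S + T) x = S x + T x. Proof. by []. Qed.
Lemma opNE T x : (- T) x = - T x. Proof. by []. Qed.
Lemma opZE c T x : (c *: T) x = c *: T x. Proof. by []. Qed.
Lemma op0E x : (0 : X -> X) x = 0. Proof. by []. Qed.

Lemma bounded_opP T c x y : bo T -> T (c *: x + y) = c *: T x + T y.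
Proof. by case/bounded_operatorsP. Qed.

Lemma bounded_op_bound T : bo T -> exists2 C, 0 <= C & operator_bound T C.
Proof. by case/bounded_operatorsP. Qed.

Lemma bounded_opD T x y : bo T -> T (x + y) = T x + T y.
Proof. by move=> /(bounded_opP 1 x y); rewrite !scale1r. Qed.

Lemma bounded_op0 T : bo T -> T 0 = 0.
Proof. by move=> /bounded_opD TD; apply: (addrI (T 0)); rewrite -TD !addr0. Qed.

Lemma bounded_opZ T c x : bo T -> T (c *: x) = c *: T x.
Proof.
by move=> bT; rewrite -[c *: x]addr0 bounded_opP// bounded_op0// addr0.
Qed.

Lemma bounded_opN T x : bo T -> T (- x) = - T x.
Proof. by move=> bT; rewrite -scaleN1r bounded_opZ// scaleN1r. Qed.

Lemma bounded_opB T x y : bo T -> T (x - y) = T x - T y.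
Proof. by move=> bT; rewrite bounded_opD// bounded_opN. Qed.

Lemma bounded_id : bo id.
Proof. by apply/bounded_operatorsP; split=> //; exists 1 => // x; rewrite mul1r. Qed.

Lemma bounded_comp S T : bo S -> bo T -> bo (S \o T).
Proof.
move=> bS bT; apply/bounded_operatorsP; split=> [c x y|].
  by rewrite /= !bounded_opP.
have [C C0 SC] := bounded_op_bound bS; have [D D0 TD] := bounded_op_bound bT.
exists (C * D); rewrite ?mulr_ge0// => x /=.
by apply: le_trans (SC _) _; rewrite -mulrA ler_wpM2l.
Qed.

Lemma bounded_subspace : is_subspace bo.
Proof.
split.
  apply/bounded_operatorsP; split=> [c x y|]; first by rewrite scaler0 addr0.
  by exists 0 => // x; rewrite (form_norm0 dotP) mul0r.
move=> c S T bS bT; apply/bounded_operatorsP; split=> [d x y|].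
  rewrite !opDE !opZE (bounded_opP _ _ _ bS) (bounded_opP _ _ _ bT).
  by rewrite !scalerDr !scalerA (mulrC c d) addrACA.
have [C C0 SC] := bounded_op_bound bS; have [D D0 TD] := bounded_op_bound bT.
exists (cmod c * C + D); rewrite ?addr_ge0 ?mulr_ge0 ?cmod_ge0// => x.
rewrite opDE opZE mulrDl; apply: le_trans (form_normD dotP _ _) _.
by rewrite lerD// (form_normZ dotP) -mulrA ler_wpM2l ?cmod_ge0.
Qed.

Lemma bounded_linear c S T : bo S -> bo T -> bo (c *: S + T).
Proof. by case: bounded_subspace => _; apply. Qed.

Lemma bounded_zero : bo 0. Proof. by case: bounded_subspace. Qed.

Lemma bounded_scale c T : bo T -> bo (c *: T).
Proof. by move=> bT; rewrite -[_ *: _]addr0; apply: bounded_linear bT bounded_zero. Qed.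

Lemma bounded_add S T : bo S -> bo T -> bo (S + T).
Proof. by move=> bS bT; rewrite -[S]scale1r; apply: bounded_linear. Qed.

Lemma bounded_opp T : bo T -> bo (- T).
Proof. by move=> bT; rewrite -scaleN1r; apply: bounded_scale. Qed.

Lemma bounded_sub S T : bo S -> bo T -> bo (S - T).
Proof. by move=> bS bT; apply: bounded_add => //; apply: bounded_opp. Qed.

Lemma bounded_sum (I : finType) (f : I -> X -> X) :
  (forall i, bo (f i)) -> bo (\sum_i f i).
Proof.
move=> bf; apply: (big_ind bo) => //; first exact: bounded_zero.
exact: bounded_add.
Qed.

Lemma opnorm_bound T : bo T -> operator_bound T (opnorm T).
Proof.
move=> bT x; have [C C0 TC] := bounded_op_bound bT.
have ubT : has_ubound [set Re `|T x| | x in [set x : X | `|x| <= 1]].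
  exists C => _ [y /= y1 <-]; rewrite hilbert_normE /=.
  apply: le_trans (TC y) _; rewrite ler_piMr//.
  by move: y1; rewrite hilbert_normE -(rmorph1 (real_complex R)) lecR.
have := form_norm_ge0 (hdot X) x; rewrite le_eqVlt => /predU1P[x0|x0].
  have -> : x = 0 by apply: hilbert_norm_eq0; rewrite -x0.
  by rewrite bounded_op0// (form_norm0 dotP) mulr0.
rewrite -ler_pdivrMr//; apply: ub_le_sup => //; exists ((nrm x)^-1%:C *: x).
  rewrite /= hilbert_normE (form_normZ dotP) cmodr ger0_norm ?invr_ge0 ?(ltW x0)//.
  by rewrite mulVf ?gt_eqF.
by rewrite bounded_opZ// hilbert_normE /= (form_normZ dotP) cmodr ger0_norm
  ?invr_ge0 ?(ltW x0)// mulrC.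
Qed.

Lemma opnorm_le T C : 0 <= C -> operator_bound T C -> opnorm T <= C.
Proof.
move=> C0 TC; apply: ge_sup.
  by exists (Re `|T 0|), 0 => //=; rewrite normr0.
move=> _ [y /= y1 <-]; rewrite hilbert_normE /=.
apply: le_trans (TC y) _; rewrite ler_piMr//.
by move: y1; rewrite hilbert_normE -(rmorph1 (real_complex R)) lecR.
Qed.

Lemma bounded_form_le T x : bo T -> Re (hdot X (T x) x) <= opnorm T * nrm x ^+ 2.
Proof.
move=> bT; apply: le_trans (psd_CauchySchwarz_Re dotP _ _) _.
by rewrite expr2 mulrA ler_wpM2r ?form_norm_ge0//; exact: opnorm_bound.
Qed.

Lemma opnormN T : opnorm (- T) = opnorm T.
Proof.
rewrite /opnorm; congr sup; apply/seteqP.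
by split=> _ [y y1 <-]; exists y; rewrite ?opNE ?normrN.
Qed.

Lemma is_adjointC S T : is_adjoint S T -> is_adjoint T S.
Proof. by move=> ST x y; rewrite (psdC dotP) -ST -(psdC dotP). Qed.

Lemma is_adjoint_unique S T U : is_adjoint S T -> is_adjoint S U -> T = U.
Proof.
move=> /is_adjointC ST /is_adjointC SU; apply/funext => x.
by apply: hdotI => t; rewrite ST SU.
Qed.

Lemma is_adjoint_comp S S' T T' :
  is_adjoint S S' -> is_adjoint T T' -> is_adjoint (S \o T) (T' \o S').
Proof. by move=> SS TT x y; rewrite /= SS TT. Qed.

Lemma is_adjoint_linear c S S' T T' :
  is_adjoint S S' -> is_adjoint T T' -> is_adjoint (c *: S + T) (Num.conj c *: S' + T').
Proof.
move=> SS TT x y; rewrite !opDE !opZE (psdDl dotP) (psdZl dotP) (psdDr dotP) (psdZr dotP).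
by rewrite conjCK SS TT.
Qed.

Lemma bounded_adjoint_ex T : bo T -> exists T', bo T' /\ is_adjoint T T'.
Proof.
move=> bT; have [C C0 TC] := bounded_op_bound bT.
have h y : exists m, forall x, hdot X y (T x) = hdot X m x.
  have [||||m _ mP] := @riesz R X setT (fun x => hdot X y (T x)) (nrm y * C).
  - by [].
  - exact: closedT.
  - by move=> c u v _ _; rewrite bounded_opP// (psdDr dotP) (psdZr dotP).
  - move=> t _; apply: le_trans (psd_CauchySchwarz dotP _ _) _.
    by rewrite -mulrA ler_wpM2l ?form_norm_ge0.
  by exists m => x; apply: mP.
have [T' T'P] := choice h.
have TT' : is_adjoint T T'.
  by apply: is_adjointC => x y; rewrite -T'P.
exists T'; split=> //; apply/bounded_operatorsP; split=> [c x y|].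
  apply: hdotI => t; rewrite -T'P (psdDl dotP) (psdZl dotP) !T'P.
  by rewrite (psdDl dotP) (psdZl dotP).
exists C => // y.
apply: (form_norm_ub dotP); first by rewrite mulr_ge0 ?form_norm_ge0.
rewrite -T'P; apply: le_trans (psd_CauchySchwarz_Re dotP _ _) _.
by rewrite (mulrC C) -mulrA ler_wpM2l ?form_norm_ge0.
Qed.

Definition adj T : X -> X := xget (0 : X -> X) [set T' | bo T' /\ is_adjoint T T'].

Lemma adj_spec T : bo T -> bo (adj T) /\ is_adjoint T (adj T).
Proof. by move=> /bounded_adjoint_ex[T' hT']; rewrite /adj; case: xgetP => [U _ //|/(_ T')]. Qed.

Lemma bounded_adj T : bo T -> bo (adj T).
Proof. by case/adj_spec. Qed.

Lemma adjP T : bo T -> is_adjoint T (adj T).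
Proof. by case/adj_spec. Qed.

Lemma adjE T T' : bo T -> is_adjoint T T' -> adj T = T'.
Proof. by move=> bT; apply: is_adjoint_unique; exact: adjP. Qed.

Lemma adjK T : bo T -> adj (adj T) = T.
Proof. by move=> bT; apply: adjE; [exact: bounded_adj|exact/is_adjointC/adjP]. Qed.

Lemma adj_comp S T : bo S -> bo T -> adj (S \o T) = adj T \o adj S.
Proof.
by move=> bS bT; apply: adjE; [exact: bounded_comp|apply: is_adjoint_comp; exact: adjP].
Qed.

Lemma adj_linear c S T : bo S -> bo T ->
  adj (c *: S + T) = Num.conj c *: adj S + adj T.
Proof.
by move=> bS bT; apply: adjE; [exact: bounded_linear|apply: is_adjoint_linear; exact: adjP].
Qed.

Lemma adj_id : adj id = id.
Proof. by apply: adjE => //; exact: bounded_id. Qed.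

(** [cstar_generated G] is an intersection over all C*-algebras that contain [G];
    this guarantees that there is one when [G] consists of bounded operators. *)
Lemma bounded_cstar_algebra : cstar_algebra bo.
Proof.
split=> //.
- exact: bounded_subspace.
- by move=> T bT; exists (adj T); [exact: adjP|exact: bounded_adj].
- exact: bounded_comp.
Qed.

Section generated.
Variables (G : set (X -> X)) (Gbo : G `<=` bo).
Local Notation A := (cstar_generated G).

Lemma cstar_generated_bounded : A `<=` bo.
Proof. by move=> T; apply; split=> //; exact: bounded_cstar_algebra. Qed.

Lemma cstar_generated_subspace : is_subspace A.
Proof.
split=> [C [[_ [C0 _]]]//|c S T AS AT C HC]; have [[_ [_ CL] _ _ _] _] := HC.
by apply: CL; [exact: AS|exact: AT].
Qed.

Lemma cstar_generated_comp S T : A S -> A T -> A (S \o T).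
Proof.
move=> AS AT C HC; have [[_ _ _ CM _] _] := HC.
by apply: CM; [exact: AS|exact: AT].
Qed.

(** Each C*-algebra of the intersection contains some adjoint of [T]; as adjoints
    are unique, it is the same one in all of them. *)
Lemma cstar_generated_adj T : A T -> A (adj T).
Proof.
move=> AT C HC; have [[Cb _ CS _ _] _] := HC; have CT := AT _ HC.
by have [T' TT' CT'] := CS _ CT; rewrite (adjE (Cb _ CT) TT').
Qed.

Lemma cstar_generated_sub : G `<=` A.
Proof. by move=> T GT C [_]; apply. Qed.

End generated.

Section selfadjoint_operators.
Variables (T : X -> X) (bT : bo T) (sT : selfadjoint T).

Lemma selfadjoint_form_real x : hdot X (T x) x = (Re (hdot X (T x) x))%:C.
Proof.
apply: eq_ReIm => //=.
suff : Im (hdot X (T x) x) = - Im (hdot X (T x) x) by lra.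
by rewrite -Im_conjC -(psdC dotP) sT.
Qed.

Lemma selfadjoint_shift_positive :
  positive_operator ((opnorm T)%:C *: (id : X -> X) + T).
Proof.
move=> x; rewrite opDE opZE (psdDl dotP) (psdZl dotP).
rewrite selfadjoint_form_real (psdE dotP) -rmorphM -rmorphD ler0c.
have := bounded_form_le x (bounded_opp bT).
by rewrite opnormN opNE (psdNl dotP) ReN; lra.
Qed.

(** By polarisation, [4 * Re <T x, y>] is the difference of the quadratic form at
    [x + y] and [x - y], and the parallelogram law bounds it by
    [2 * c * (|x|^2 + |y|^2)]; one then takes for [y] a multiple of [T x]. *)
Lemma selfadjoint_opnorm_le (c : R) : 0 <= c ->
  (forall x, `|Re (hdot X (T x) x)| <= c * nrm x ^+ 2) -> opnorm T <= c.
Proof.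
move=> c0 Tc; apply: opnorm_le => // x.
have polar y : 2 * Re (hdot X (T x) y) <= c * (nrm x ^+ 2 + nrm y ^+ 2).
  have := Tc (x + y); have := Tc (x - y).
  rewrite bounded_opB// bounded_opD// !(psdBl dotP) !(psdDl dotP) !(psdBr dotP) !(psdDr dotP).
  rewrite (sT y x) (psdC dotP (T x) y) !(ReB, ReD, Re_conjC).
  rewrite !(form_norm_sqr dotP) !(psdBl dotP) !(psdDl dotP) !(psdBr dotP) !(psdDr dotP).
  rewrite (psdC dotP x y) !(ReB, ReD, Re_conjC).
  rewrite !ler_norml => /andP[h1 h2] /andP[h3 h4]; lra.
rewrite -(@ler_pXn2r _ 2)// ?nnegrE ?mulr_ge0 ?form_norm_ge0//.
have := discriminant (a := c * nrm x ^+ 2) (b := - nrm (T x) ^+ 2) (d := c * nrm (T x) ^+ 2).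
move=> /(_ _ _)/[!sqrrN] h.
have := form_norm_ge0 (hdot X) (T x); rewrite le_eqVlt => /predU1P[<-|Tx0].
  by rewrite expr0n sqr_ge0.
have {}h : (nrm (T x) ^+ 2) ^+ 2 <= c * nrm x ^+ 2 * (c * nrm (T x) ^+ 2).
  apply: h => [|r]; first by rewrite mulr_ge0 ?sqr_ge0.
  have := polar (r%:C *: T x).
  rewrite (psdZr dotP) conjr Re_realM -(form_norm_sqr dotP) (form_normZ dotP) cmodr.
  rewrite exprMn real_normK ?num_real//; nra.
rewrite -(ler_pM2r (exprn_gt0 2 Tx0)) -expr2; apply: le_trans h _.
by rewrite le_eqVlt; apply/orP; left; apply/eqP; ring.
Qed.

End selfadjoint_operators.

(** On bounded operators this is the support functional of the set of states. *)
Definition numerical_sup T : R :=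
  sup [set Re (hdot X (T x) x) | x in [set x | nrm x = 1]].

Lemma numerical_sup_ub T x : bo T -> Re (hdot X (T x) x) <= numerical_sup T * nrm x ^+ 2.
Proof.
move=> bT.
have := form_norm_ge0 (hdot X) x; rewrite le_eqVlt => /predU1P[x0|x0].
  have -> : x = 0 by apply: hilbert_norm_eq0; rewrite -x0.
  by rewrite (psd0r dotP) (form_norm0 dotP) expr0n mulr0.
rewrite -ler_pdivrMr ?exprn_gt0//; apply: ub_le_sup.
  exists (opnorm T) => _ [y /= y1 <-].
  by have := bounded_form_le y bT; rewrite y1 expr1n mulr1.
exists ((nrm x)^-1%:C *: x).
  rewrite /= (form_normZ dotP) cmodr ger0_norm ?invr_ge0 ?(ltW x0)//.
  by rewrite mulVf ?gt_eqF.
rewrite bounded_opZ// (psdZl dotP) (psdZr dotP) conjr !Re_realM; field.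
by rewrite gt_eqF.
Qed.

Section nontrivial.
Variables (x0 : X) (x0N0 : x0 != 0).

Lemma unit_vector_ex : exists x, nrm x = 1.
Proof.
have n0 : 0 < nrm x0.
  rewrite lt_def form_norm_ge0 andbT; apply: contra_neq x0N0 => h.
  by apply: hilbert_norm_eq0; rewrite h.
exists ((nrm x0)^-1%:C *: x0).
by rewrite (form_normZ dotP) cmodr ger0_norm ?invr_ge0 ?(ltW n0)// mulVf ?gt_eqF.
Qed.

Lemma numerical_sup_le T (c : R) :
  (forall x, Re (hdot X (T x) x) <= c * nrm x ^+ 2) -> numerical_sup T <= c.
Proof.
move=> Tc; have [u u1] := unit_vector_ex; apply: ge_sup.
  by exists (Re (hdot X (T u) u)), u.
by move=> _ [y /= y1 <-]; have := Tc y; rewrite y1 expr1n mulr1.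
Qed.

Lemma numerical_supD S T : bo S -> bo T ->
  numerical_sup (S + T) <= numerical_sup S + numerical_sup T.
Proof.
move=> bS bT; apply: numerical_sup_le => x.
by rewrite opDE (psdDl dotP) ReD mulrDl lerD// numerical_sup_ub.
Qed.

Lemma numerical_supZ (r : R) T : bo T -> 0 <= r ->
  numerical_sup (r%:C *: T) = r * numerical_sup T.
Proof.
have le (s : R) S : bo S -> 0 <= s -> numerical_sup (s%:C *: S) <= s * numerical_sup S.
  move=> bS s0; apply: numerical_sup_le => x.
  by rewrite opZE (psdZl dotP) Re_realM -mulrA ler_wpM2l// numerical_sup_ub.
move=> bT; rewrite le_eqVlt => /predU1P[<-|r0].
  rewrite mul0r; have -> : 0%:C *: T = 0 by rewrite scale0r.
  have [u u1] := unit_vector_ex; apply/le_anti/andP; split.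
    by apply: numerical_sup_le => x; rewrite op0E (psd0l dotP) mul0r.
  have := numerical_sup_ub u bounded_zero.
  by rewrite op0E (psd0l dotP) u1 expr1n mulr1.
apply/le_anti; rewrite le ?(ltW r0)//= -ler_pdivlMl//.
have bT' := bounded_scale r%:C bT.
have := le r^-1 _ bT'; rewrite invr_ge0 (ltW r0) => /(_ isT).
by rewrite scalerA -rmorphM mulVf ?gt_eqF// scale1r.
Qed.

Lemma numerical_sup_scalar (r : R) : numerical_sup (r%:C *: (id : X -> X)) = r.
Proof.
have E x : Re (hdot X ((r%:C *: (id : X -> X)) x) x) = r * nrm x ^+ 2.
  by rewrite opZE (psdZl dotP) Re_realM -(form_norm_sqr dotP).
apply/le_anti/andP; split; first by apply: numerical_sup_le => x; rewrite E.
have [u u1] := unit_vector_ex.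
have := numerical_sup_ub u (bounded_scale r%:C bounded_id).
by rewrite E u1 expr1n !mulr1.
Qed.

Section top.
Variables (T : X -> X) (bT : bo T) (sT : selfadjoint T).
Hypothesis TN : numerical_sup (- T) <= numerical_sup T.

Lemma numerical_sup_ge0 : 0 <= numerical_sup T.
Proof.
have := numerical_supD bT (bounded_opp bT); rewrite subrr.
have := numerical_sup_scalar 0; rewrite scale0r => ->.
by move: TN; lra.
Qed.

Lemma selfadjoint_opnorm_numerical : opnorm T <= numerical_sup T.
Proof.
apply: (selfadjoint_opnorm_le bT sT numerical_sup_ge0) => x.
have h := numerical_sup_ub x (bounded_opp bT).
rewrite ler_norml numerical_sup_ub// andbT -lerN2 opprK.
apply: (@le_trans _ _ (numerical_sup (- T) * nrm x ^+ 2)).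
  by move: h; rewrite opNE (psdNl dotP) ReN.
by rewrite ler_wpM2r ?sqr_ge0.
Qed.

Lemma numerical_sup_gt0 : T <> 0 -> 0 < numerical_sup T.
Proof.
move=> TN0; rewrite lt_def numerical_sup_ge0 andbT; apply/eqP => w0; apply: TN0.
apply/funext => x; apply: hilbert_norm_eq0; apply: le_trans (opnorm_bound bT x) _.
rewrite -(mul0r (nrm x)) ler_wpM2r ?form_norm_ge0//.
by rewrite -w0; exact: selfadjoint_opnorm_numerical.
Qed.

End top.
End nontrivial.
End operators.


(** * Extreme points and extensions through sublinear functionals *)

(** A compact convex set of real-linear functionals is determined by its support
    functional, the supremum of its elements, which is sublinear; the set
    consists of the real-linear functionals dominated by it. Spaces are complex
    because real-linear functionals serve as real parts of complex ones. *)
Section sublinear.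
Context {R : realType} {V : lmodType R[i]}.
Implicit Types (x y t : V) (r l : R) (p q g : V -> R).

Definition sublinear q :=
  (forall x y, q (x + y) <= q x + q y) /\
  (forall r x, 0 <= r -> q (r%:C *: x) = r * q x).

Definition real_linear g :=
  (forall x y, g (x + y) = g x + g y) /\ (forall r x, g (r%:C *: x) = r * g x).

Definition dominated g q := forall x, g x <= q x.

Lemma sublinearI q : (forall x y, q (x + y) <= q x + q y) ->
  (forall r x, 0 < r -> q (r%:C *: x) <= r * q x) -> q 0 = 0 -> sublinear q.
Proof.
move=> qD qZ q0; split=> // r x; rewrite le_eqVlt => /predU1P[<-|r0].
  by rewrite scale0r mul0r.
apply/le_anti; rewrite qZ//= -ler_pdivlMl//.
have := qZ r^-1 (r%:C *: x); rewrite invr_gt0 => /(_ r0).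
by rewrite scalerA -rmorphM mulVf ?gt_eqF// scale1r.
Qed.

Lemma sublinear0 q : sublinear q -> q 0 = 0.
Proof. by case=> _ /(_ 0 0 (lexx _)); rewrite scaler0 mul0r. Qed.

Lemma sublinear_lower q x : sublinear q -> - q (- x) <= q x.
Proof. by move=> hq; have := hq.1 x (- x); rewrite subrr sublinear0//; lra. Qed.

Lemma real_linear0 g : real_linear g -> g 0 = 0.
Proof. by case=> _ /(_ 0 0); rewrite scaler0 mul0r. Qed.

Lemma real_linearN g x : real_linear g -> g (- x) = - g x.
Proof. by move=> hg; have := hg.1 x (- x); rewrite subrr real_linear0//; lra. Qed.

Lemma real_linearB g x y : real_linear g -> g (x - y) = g x - g y.
Proof. by move=> hg; rewrite hg.1 real_linearN. Qed.

Lemma dominated_eq g1 g2 : real_linear g1 -> real_linear g2 ->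
  dominated g1 g2 -> g1 =1 g2.
Proof.
move=> h1 h2 le12 x; apply/le_anti; rewrite le12/=.
by have := le12 (- x); rewrite !real_linearN// lerN2.
Qed.

Section exposed_face.
Variables (q : V -> R) (hq : sublinear q) (t : V).

(** Support functional of the face formed by the functionals dominated by [q]
    that have the largest possible value, [q t], at [t]. *)
Definition exposed_face x : R :=
  inf [set q (x + l%:C *: t) - l * q t | l in [set l : R | 0 <= l]].

Let slope_lb x l : 0 <= l -> - q (- x) <= q (x + l%:C *: t) - l * q t.
Proof.
move=> l0; have := hq.1 (x + l%:C *: t) (- x).
by rewrite addrAC subrr add0r hq.2//; lra.
Qed.

Lemma exposed_face_le x l : 0 <= l -> exposed_face x <= q (x + l%:C *: t) - l * q t.
Proof.
move=> l0; apply: ge_inf; last by exists l.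
by exists (- q (- x)) => _ [m /= m0 <-]; exact: slope_lb.
Qed.

Lemma exposed_face_ge x r :
  (forall l, 0 <= l -> r <= q (x + l%:C *: t) - l * q t) -> r <= exposed_face x.
Proof.
move=> h; apply: lb_le_inf; first by exists (q (x + 0%:C *: t) - 0 * q t), 0 => /=.
by move=> _ [m /= m0 <-]; exact: h.
Qed.

Lemma exposed_face_sublinear : sublinear exposed_face.
Proof.
apply: sublinearI => [x y|r x r0|].
- rewrite -lerBlDr; apply: exposed_face_ge => l l0.
  rewrite lerBlDr -lerBlDl; apply: exposed_face_ge => m m0.
  have := exposed_face_le (x + y) (addr_ge0 l0 m0).
  rewrite rmorphD scalerDl addrACA.
  have := hq.1 (x + l%:C *: t) (y + m%:C *: t); lra.
- rewrite -ler_pdivrMl//; apply: exposed_face_ge => l l0.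
  rewrite ler_pdivrMl//.
  have := exposed_face_le (r%:C *: x) (mulr_ge0 (ltW r0) l0).
  by rewrite rmorphM -scalerA -scalerDr hq.2 ?(ltW r0)// mulrBr mulrA.
- apply/le_anti/andP; split.
    have := exposed_face_le 0 (lexx 0).
    by rewrite scale0r addr0 mul0r subr0 (sublinear0 hq).
  by apply: exposed_face_ge => l l0; rewrite add0r hq.2// subrr.
Qed.

Lemma exposed_face_dominated : dominated exposed_face q.
Proof.
by move=> x; have := exposed_face_le x (lexx 0); rewrite scale0r addr0 mul0r subr0.
Qed.

Lemma exposed_faceN : exposed_face (- t) <= - q t.
Proof.
have := exposed_face_le (- t) ler01.
by rewrite scale1r addNr (sublinear0 hq) mul1r sub0r.
Qed.

End exposed_face.

(** Zorn's lemma gives a minimal sublinear functional [q] among those whose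
    convex set is a face of the convex set of [p]. The faces that [q] exposes are
    again faces of [p], so [q] equals each of them; hence [q (- t) = - q t] for
    all [t], and [q] is linear: the minimal face is a point. *)
Lemma extreme_functional p : sublinear p ->
  exists g, [/\ real_linear g, dominated g p &
    forall g1 g2 r, real_linear g1 -> real_linear g2 ->
      dominated g1 p -> dominated g2 p -> 0 < r < 1 ->
      (forall x, r * g1 x + (1 - r) * g2 x = g x) -> g1 =1 g].
Proof.
move=> hp.
pose face q := forall g1 g2 r, real_linear g1 -> real_linear g2 ->
  dominated g1 p -> dominated g2 p -> 0 < r < 1 ->
  dominated (fun x => r * g1 x + (1 - r) * g2 x) q -> dominated g1 q.
pose T := {q : V -> R | [/\ sublinear q, dominated q p & face q]}.
have Tp : [/\ sublinear p, dominated p p & face p] by split=> // [x|g1 g2 r _ _ d1].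
pose below (s s' : T) := `[< dominated (sval s') (sval s) >].
have [||A totA|[q [hq qp qface]] qmin] := @ZL_preorder T (exist _ p Tp) below.
- by move=> s; apply/asboolP => x.
- move=> s1 s2 s3 /asboolP h1 /asboolP h2; apply/asboolP => x.
  exact: le_trans (h2 x) (h1 x).
- have [[s0 As0]|A0] := pselect (exists s, A s); last first.
    by exists (exist _ p Tp) => s As; case: A0; exists s.
  pose q x := inf [set sval s x | s in A].
  have q_le x s : A s -> q x <= sval s x.
    move=> As; apply: ge_inf; last by exists s.
    exists (- p (- x)) => _ [s' _ <-]; case: s' => s' /= [hs' sp _].
    by apply: le_trans (sublinear_lower x hs'); rewrite lerN2.
  have q_ge x r : (forall s, A s -> r <= sval s x) -> r <= q x.
    move=> h; apply: lb_le_inf; first by exists (sval s0 x), s0.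
    by move=> _ [s As <-]; exact: h.
  have hq : sublinear q.
    apply: sublinearI => [x y|r x r0|].
    + rewrite -lerBlDr; apply: (q_ge) => s As.
      rewrite lerBlDr -lerBlDl; apply: (q_ge) => s' As'; rewrite lerBlDl.
      have [ss'|ss'] := totA _ _ As As'.
        move/asboolP : ss' => ss'; apply: le_trans (q_le _ _ As') _.
        by case: s' ss' {As'} => s' /= [hs' _ _] ss'; apply: le_trans (hs'.1 _ _) _; rewrite lerD2r.
      move/asboolP : ss' => ss'; apply: le_trans (q_le _ _ As) _.
      by case: s ss' {As} => s /= [hs _ _] ss'; apply: le_trans (hs.1 _ _) _; rewrite lerD2l.
    + rewrite -ler_pdivrMl//; apply: (q_ge) => s As; rewrite ler_pdivrMl//.
      apply: le_trans (q_le _ _ As) _; case: s {As} => s /= [hs _ _].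
      by rewrite hs.2// ltW.
    + apply/le_anti/andP; split.
        by apply: le_trans (q_le _ _ As0) _; case: s0 {As0} => s /= [/sublinear0-> _ _].
      by apply: (q_ge) => -[s [hs sp sf]] As /=; rewrite (sublinear0 hs).
  have qp : dominated q p.
    by move=> x; apply: le_trans (q_le _ _ As0) _; case: s0 {As0} => s /= [_ + _].
  have qface : face q.
    move=> g1 g2 r h1 h2 d1 d2 r01 d x; apply: (q_ge) => s As.
    case: s (q_le ^~ s) As => s /= [hs sp sface] /= s_le As.
    apply: (sface) h1 h2 d1 d2 r01 _ x => x.
    by apply: le_trans (d x) _; exact: (q_le x _ As).
  by exists (exist _ q (And3 hq qp qface)) => s As; apply/asboolP => x; exact: q_le.
have {}qmin q' : sublinear q' -> dominated q' q -> face q' -> dominated q q'.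
  move=> hq' q'q q'face.
  have q'p : dominated q' p by move=> x; exact: le_trans (q'q x) (qp x).
  have := qmin (exist _ q' (And3 hq' q'p q'face)).
  by move=> /(_ (asboolT q'q)) /asboolP.
have qN x : q (- x) = - q x.
  apply/le_anti/andP; split; last first.
    by have := sublinear_lower (- x) hq; rewrite opprK.
  apply: le_trans (exposed_faceN hq x); apply: qmin.
  - exact: exposed_face_sublinear.
  - exact: exposed_face_dominated.
  - move=> g1 g2 r h1 h2 d1 d2 r01 d.
    have dq y : r * g1 y + (1 - r) * g2 y <= q y.
      by apply: le_trans (d y) _; exact: exposed_face_dominated.
    have r01' : 0 < 1 - r < 1 by move: r01 => /andP[]; lra.
    have g1q := qface _ _ _ h1 h2 d1 d2 r01 dq.
    have g2q : dominated g2 q.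
      apply: (qface _ _ _ h2 h1 d2 d1 r01') => y.
      by have := dq y; rewrite addrC; apply: le_trans; rewrite subKr.
    have g1x : g1 x = q x.
      apply/le_anti/andP; split; first exact: g1q.
      have := le_trans (d (- x)) (exposed_faceN hq x).
      rewrite !real_linearN//; have := g2q x.
      by move: r01 => /andP[r0 r1]; nra.
    move=> y; apply: exposed_face_ge => l l0.
    have := g1q (y + l%:C *: x); rewrite h1.1 h1.2 g1x; lra.
have qlin : real_linear q.
  split=> [x y|r x].
    apply/le_anti; rewrite hq.1/=.
    have := hq.1 (x + y) (- y); rewrite addrK qN; lra.
  have [r0|r0] := leP 0 r; first exact: hq.2.
  have := hq.2 (- r) x; rewrite rmorphN scaleNr qN oppr_ge0 => /(_ (ltW r0)).
  lra.
exists q; split=> // g1 g2 r h1 h2 d1 d2 r01 d.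
apply: dominated_eq => //; apply: qface h1 h2 d1 d2 r01 _ => x.
by rewrite d.
Qed.

End sublinear.

Section extension.
Context {R : realType} {V E : lmodType R[i]}.
Variables (i : V -> E) (q : E -> R) (g : V -> R).
Hypotheses (iD : forall x y, i (x + y) = i x + i y)
           (iZ : forall (r : R) x, i (r%:C *: x) = r%:C *: i x)
           (hq : sublinear q) (hg : real_linear g) (gq : forall x, g x <= q (i x)).

(** The functional [p] of the proof is the support functional of the set of
    dominated extensions of [g], and any linear functional below it is one. *)
Lemma dominated_extension : exists h,
  [/\ real_linear h, dominated h q & forall x, h (i x) = g x].
Proof.
have i0 : i 0 = 0 by have := iZ 0 0; rewrite !scale0r.
have iN x : i (- x) = - i x.
  by apply: (addrI (i x)); rewrite -iD !subrr i0.
pose p y := inf [set q (y - i v) + g v | v in setT].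
have lb y v : - q (- y) <= q (y - i v) + g v.
  have := hq.1 (y - i v) (- y); rewrite addrAC subrr add0r -iN.
  have := gq (- v); rewrite real_linearN//; lra.
have p_le y v : p y <= q (y - i v) + g v.
  apply: ge_inf; last by exists v.
  by exists (- q (- y)) => _ [w _ <-]; exact: lb.
have p_ge y r : (forall v, r <= q (y - i v) + g v) -> r <= p y.
  move=> h; apply: lb_le_inf; first by exists (q (y - i 0) + g 0), 0.
  by move=> _ [v _ <-]; exact: h.
have hp : sublinear p.
  apply: sublinearI => [x y|r x r0|].
  - rewrite -lerBlDr; apply: (p_ge) => v; rewrite lerBlDr -lerBlDl.
    apply: (p_ge) => w; have := p_le (x + y) (v + w).
    rewrite iD hg.1 opprD addrACA; have := hq.1 (x - i v) (y - i w); lra.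
  - rewrite -ler_pdivrMl//; apply: (p_ge) => v; rewrite ler_pdivrMl//.
    have := p_le (r%:C *: x) (r%:C *: v).
    by rewrite iZ -scalerBr hq.2 ?(ltW r0)// hg.2 mulrDr.
  - apply/le_anti/andP; split.
      by have := p_le 0 0; rewrite i0 subr0 (sublinear0 hq) real_linear0// addr0.
    by apply: (p_ge) => v; have := lb 0 v; rewrite oppr0 (sublinear0 hq) oppr0.
have [h [hlin hp' _]] := extreme_functional hp.
exists h; split=> //.
  move=> y; apply: le_trans (hp' y) _; have := p_le y 0.
  by rewrite i0 subr0 real_linear0// addr0.
have le v : h (i v) <= g v.
  by apply: le_trans (hp' _) _; have := p_le (i v) v; rewrite subrr (sublinear0 hq) add0r.
move=> v; apply/le_anti; rewrite le/=.
have := le (- v); rewrite iN !real_linearN//; lra.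
Qed.

End extension.


(** * Positive functionals and their GNS forms *)

Section positive_functionals.
Context {R : realType} {H : hilbertType R}.
Implicit Types (S T X Y Z : H -> H) (c : R[i]).
Local Notation bo := (@bounded_operators R H).
Local Notation dotP := (@hdot_psd R H).
Local Notation nrm := (form_norm (hdot H)).

Definition positive_functional (psi : (H -> H) -> R[i]) :=
  (forall c S T, bo S -> bo T -> psi (c *: S + T) = c * psi S + psi T) /\
  (forall T, bo T -> positive_operator T -> 0 <= psi T).

Variables (psi : (H -> H) -> R[i]) (hpsi : positive_functional psi).

Lemma functionalP c S T : bo S -> bo T -> psi (c *: S + T) = c * psi S + psi T.
Proof. exact: hpsi.1. Qed.

Lemma functionalD S T : bo S -> bo T -> psi (S + T) = psi S + psi T.
Proof. by move=> bS bT; rewrite -[S]scale1r functionalP// mul1r scale1r. Qed.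

Lemma functional0 : psi 0 = 0.
Proof.
apply: (addrI (psi 0)); rewrite -functionalD; try exact: bounded_zero.
by rewrite !addr0.
Qed.

Lemma functionalZ c T : bo T -> psi (c *: T) = c * psi T.
Proof.
move=> bT; rewrite -[c *: T]addr0 functionalP//; last exact: bounded_zero.
by rewrite functional0 addr0.
Qed.

Lemma functionalN T : bo T -> psi (- T) = - psi T.
Proof. by move=> bT; rewrite -scaleN1r functionalZ// mulN1r. Qed.

Lemma functionalB S T : bo S -> bo T -> psi (S - T) = psi S - psi T.
Proof.
by move=> bS bT; rewrite functionalD ?functionalN//; exact: bounded_opp.
Qed.

Lemma functional_sum (I : finType) (f : I -> H -> H) :
  (forall i, bo (f i)) -> psi (\sum_i f i) = \sum_i psi (f i).
Proof.
move=> bf.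
suff [] : bo (\sum_i f i) /\ psi (\sum_i f i) = \sum_i psi (f i) by [].
apply: (big_rec2 (fun T z => bo T /\ psi T = z)) => [|i z T _ [bT <-]].
  by split; [exact: bounded_zero|exact: functional0].
by split; [exact: bounded_add|rewrite functionalD].
Qed.

Lemma positive_square T : bo T -> positive_operator (adj T \o T).
Proof.
by move=> bT x; rewrite /= (is_adjointC (adjP bT)) (psd_ge0 dotP).
Qed.

(** A self-adjoint operator becomes positive after adding a multiple of the
    identity. *)
Lemma functional_selfadjoint T : bo T -> selfadjoint T -> Im (psi T) = 0.
Proof.
move=> bT sT; pose S : H -> H := (opnorm T)%:C *: id + T.
have bS : bo S by apply: bounded_linear bT; exact: bounded_id.
have S0 : positive_operator S by exact: selfadjoint_shift_positive.
have := hpsi.2 _ bS S0.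
rewrite /S functionalP//; last exact: bounded_id.
have := hpsi.2 _ bounded_id (fun x => psd_ge0 dotP x).
rewrite !ge0_ReIm => /andP[/eqP i0 _] /andP[/eqP + _].
by rewrite ImD Im_realM i0 mulr0 add0r.
Qed.

Lemma functional_adj T : bo T -> psi (adj T) = Num.conj (psi T).
Proof.
move=> bT; have bT' := bounded_adj bT; have aT := adjP bT.
have h1 : Im (psi (T + adj T)) = 0.
  apply: functional_selfadjoint; first exact: bounded_add.
  move=> x y; rewrite !opDE (psdDl dotP) (psdDr dotP) addrC.
  by rewrite (is_adjointC aT) aT.
have h2 : Im (psi ('i *: T - 'i *: adj T)) = 0.
  apply: functional_selfadjoint.
    by apply: bounded_sub; apply: bounded_scale.
  move=> x y; rewrite !opDE !opNE !opZE (psdBl dotP) (psdBr dotP) !(psdZl dotP) !(psdZr dotP).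
  by rewrite (is_adjointC aT) aT conji; ring.
move: h1 h2; rewrite functionalD// functionalB; try exact: bounded_scale.
rewrite !functionalZ//.
case: (psi T) => a b; case: (psi (adj T)) => a' b' /= h1 h2.
by apply: eq_ReIm => /=; lra.
Qed.

Lemma functional_accretive T : bo T -> (forall x, 0 <= Re (hdot H (T x) x)) ->
  0 <= Re (psi T).
Proof.
move=> bT T0; have bT' := bounded_adj bT; have aT := adjP bT.
have : 0 <= psi (T + adj T).
  apply: hpsi.2; first exact: bounded_add.
  move=> x; rewrite opDE (psdDl dotP) (is_adjointC aT) (psdC dotP (T x) x).
  by rewrite ge0_ReIm ImD Im_conjC subrr eqxx ReD Re_conjC addr_ge0.
rewrite functionalD// functional_adj// ge0_ReIm => /andP[_].
by rewrite ReD Re_conjC; lra.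
Qed.

Lemma functional_mono S T : bo S -> bo T ->
  (forall x, Re (hdot H (S x) x) <= Re (hdot H (T x) x)) -> Re (psi S) <= Re (psi T).
Proof.
move=> bS bT ST; rewrite -subr_ge0 -ReB -functionalB//.
apply: functional_accretive; first exact: bounded_sub.
by move=> x; rewrite opDE opNE (psdBl dotP) ReB subr_ge0.
Qed.

Section form.
Variables (M : set (H -> H)) (HM : is_subspace M) (Mb : M `<=` bo).

Definition functional_form (X Y : subspace_of HM) := psi (adj (val Y) \o val X).

Let bv (X : subspace_of HM) : bo (val X). Proof. by apply: Mb; exact: (subspaceP X). Qed.

Lemma functional_form_psd : psd_form functional_form.
Proof.
split=> [c X X' Y|X Y|X].
- have bY := bounded_adj (bv Y).
  rewrite /functional_form subspace_valP -functionalP; try by apply: bounded_comp.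
  congr psi; apply/funext => x.
  exact: (bounded_opP c (val X x) (val X' x) bY).
- have bY := bounded_adj (bv Y).
  rewrite /functional_form -functional_adj; last exact: bounded_comp.
  by rewrite adj_comp// adjK.
- apply: hpsi.2; last exact: positive_square.
  by apply: bounded_comp => //; exact: bounded_adj.
Qed.

End form.

Lemma functional_CauchySchwarz S T : bo S -> bo T ->
  cmod (psi (adj T \o S)) <=
  Num.sqrt (Re (psi (adj S \o S))) * Num.sqrt (Re (psi (adj T \o T))).
Proof.
move=> bS bT; have h := functional_form_psd bounded_subspace (fun x => id).
exact: (psd_CauchySchwarz h (in_subspace bounded_subspace bS) (in_subspace bounded_subspace bT)).
Qed.

End positive_functionals.


Lemma hdot_opP (R : realType) (X : hilbertType R) (c : R[i]) (S T : X -> X) x y :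
  hdot X ((c *: S + T) x) y = c * hdot X (S x) y + hdot X (T x) y.
Proof. by rewrite opDE opZE (psdDl (@hdot_psd R X)) (psdZl (@hdot_psd R X)). Qed.

(** * Compression to the GNS space of a subspace of operators *)

Fact compression_key : unit. Proof. exact: tt. Qed.

Section compression.
Context {R : realType} {H : hilbertType R}.
Local Notation bo := (@bounded_operators R H).
Variables (psi : (H -> H) -> R[i]) (hpsi : positive_functional psi).
Variables (M : set (H -> H)) (HM : is_subspace M) (Mb : M `<=` bo).
Let hB := functional_form_psd hpsi HM Mb.
Let L := completion_hilbert hB.
Local Notation V := (subspace_of HM).
Local Notation dot := (hdot L).
Local Notation dotP := (@hdot_psd R L).
Local Notation nrm := (form_norm (hdot L)).
Implicit Types (D S T Z : H -> H) (X Y : V) (f g : L) (c : R[i]).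

Definition gns_space : hilbertType R := L.

Let bv X : bo (val X). Proof. by apply: Mb; exact: (subspaceP X). Qed.
Let bav X : bo (adj (val X)). Proof. by apply: bounded_adj. Qed.
Local Hint Resolve bv bav : core.

Definition gns_vector X : L := to_completion hB X.
Local Notation iota := gns_vector.

(** The default value [0] avoids carrying proofs of boundedness. *)
Definition gns_functional (F : V -> R[i]) : L :=
  if pselect (bounded_antilinear (functional_form psi (HM := HM)) F) is left p
  then in_subspace _ p else 0.

Lemma gns_functionalE F : bounded_antilinear (functional_form psi (HM := HM)) F ->
  val (gns_functional F : completion hB) = F.
Proof. by rewrite /gns_functional; case: pselect. Qed.

Lemma gns_eqP f g : (forall X, dot f (iota X) = dot g (iota X)) -> f = g.
Proof.
move=> fg; apply: (@completion_eqP _ _ _ hB) => X.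
have := fg X; rewrite -[dot f _]/(completion_dot f (to_completion hB X)).
by rewrite -[dot g _]/(completion_dot g (to_completion hB X)) !completion_dotr.
Qed.

Lemma gns_dotr f X : dot f (iota X) = val (f : completion hB) X.
Proof. exact: completion_dotr. Qed.

Lemma gns_dot X Y : dot (iota X) (iota Y) = psi (adj (val Y) \o val X).
Proof. exact: gns_dotr. Qed.

Lemma gns_dense f e : 0 < e -> exists X, nrm (f - iota X) <= e.
Proof. exact: completion_dense. Qed.

(** In the GNS space of [psi] on all bounded operators, [Z] gives a vector; this
    is its orthogonal projection onto the closed subspace generated by [M]. *)
Definition project_vector Z : L := gns_functional (fun X => psi (adj (val X) \o Z)).
Local Notation vec := project_vector.

Lemma project_vector_subproof Z : bo Z ->
  bounded_antilinear (functional_form psi (HM := HM)) (fun X => psi (adj (val X) \o Z)).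
Proof.
move=> bZ; split=> [c X Y _ _|].
  rewrite subspace_valP adj_linear//.
  exact: (functionalP hpsi _ (bounded_comp (bav X) bZ) (bounded_comp (bav Y) bZ)).
exists (Num.sqrt (Re (psi (adj Z \o Z)))); first exact: sqrtr_ge0.
by move=> X; exact: (functional_CauchySchwarz hpsi bZ (bv X)).
Qed.

Lemma project_vectorE Z X : bo Z -> dot (vec Z) (iota X) = psi (adj (val X) \o Z).
Proof. by move=> bZ; rewrite gns_dotr gns_functionalE//; exact: project_vector_subproof. Qed.

Lemma project_vector_val X : vec (val X) = iota X.
Proof. by apply: gns_eqP => Y; rewrite project_vectorE// gns_dot. Qed.

Lemma project_vectorP c S T : bo S -> bo T -> vec (c *: S + T) = c *: vec S + vec T.
Proof.
move=> bS bT; apply: gns_eqP => X.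
rewrite (psdDl dotP) (psdZl dotP) !project_vectorE//; last exact: bounded_linear.
rewrite -(functionalP hpsi); try exact: bounded_comp.
by congr psi; apply/funext => x; exact: (bounded_opP c (S x) (T x) (bav X)).
Qed.

Lemma project_vector_norm Z : bo Z -> nrm (vec Z) <= Num.sqrt (Re (psi (adj Z \o Z))).
Proof.
move=> bZ; apply: (@completion_norm_le _ _ _ hB); first exact: sqrtr_ge0.
move=> X; rewrite [val _ _](_ : _ = psi (adj (val X) \o Z)).
  exact: (functional_CauchySchwarz hpsi bZ (bv X)).
by rewrite -project_vectorE// gns_dotr.
Qed.

Lemma project_vector_norm_comp D X (C : R) : bo D -> 0 <= C -> operator_bound D C ->
  nrm (vec (D \o val X)) <= C * nrm (iota X).
Proof.
move=> bD C0 DC; have bDX : bo (D \o val X) by exact: bounded_comp.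
apply: le_trans (project_vector_norm bDX) _.
rewrite -(@ler_pXn2r _ 2)// ?nnegrE ?sqrtr_ge0 ?mulr_ge0 ?form_norm_ge0//.
have Hp := @hdot_psd R H.
rewrite exprMn (form_norm_sqr dotP) gns_dot sqr_sqrtr; last first.
  have := hpsi.2 _ (bounded_comp (bounded_adj bDX) bDX) (positive_square bDX).
  by rewrite ge0_ReIm => /andP[].
rewrite -Re_realM -(functionalZ hpsi) //; last exact: bounded_comp.
apply: (functional_mono hpsi).
- by apply: bounded_comp => //; exact: bounded_adj.
- by apply: bounded_scale; exact: bounded_comp.
move=> x; rewrite opZE (psdZl Hp) Re_realM /= (is_adjointC (adjP bDX)).
rewrite (is_adjointC (adjP (bv X))) -!(form_norm_sqr Hp) /= -exprMn.
by rewrite ler_pXn2r// ?nnegrE ?mulr_ge0 ?form_norm_ge0.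
Qed.

(** The operator on the GNS space of [M] obtained from [D], acting on the GNS space
    of [psi] on all bounded operators, by restriction and projection. It is
    defined through its adjoint, which is known on the vectors of [M]. *)
Definition compression_def D (f : L) : L :=
  gns_functional (fun Y => dot f (vec (adj D \o val Y))).

(** Sealed, so that comparing the compressions of two different operators does
    not unfold the construction of the completion. *)
Definition compression : (H -> H) -> L -> L :=
  locked_with compression_key compression_def.
Local Notation theta := compression.

Lemma compression_subproof D f : bo D ->
  bounded_antilinear (functional_form psi (HM := HM)) (fun Y => dot f (vec (adj D \o val Y))).
Proof.
move=> bD; have bD' := bounded_adj bD; split=> [c X Y _ _|].
  rewrite -(psdZr dotP) -(psdDr dotP) -project_vectorP; try exact: bounded_comp.
  rewrite subspace_valP; congr (dot f (vec _)); apply/funext => x.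
  exact: (bounded_opP c (val X x) (val Y x) bD').
have [C C0 DC] := bounded_op_bound bD'.
exists (nrm f * C); first by rewrite mulr_ge0// form_norm_ge0.
move=> Y; apply: le_trans (psd_CauchySchwarz dotP _ _) _.
rewrite -mulrA; apply: ler_wpM2l; first exact: form_norm_ge0.
by apply: le_trans (project_vector_norm_comp Y bD' C0 DC) _; rewrite /form_norm gns_dot.
Qed.

Lemma compressionE D f Y : bo D ->
  dot (theta D f) (iota Y) = dot f (vec (adj D \o val Y)).
Proof. move=> bD; rewrite gns_dotr /theta unlock gns_functionalE//.
exact: compression_subproof.
Qed.

Lemma compression_gns D X : bo D -> theta D (iota X) = vec (D \o val X).
Proof.
move=> bD; have bD' := bounded_adj bD; apply: gns_eqP => Y.
have bDX : bo (D \o val X) by exact: bounded_comp.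
have bDY : bo (adj D \o val Y) by exact: bounded_comp.
rewrite compressionE// project_vectorE// (psdC dotP) project_vectorE//.
rewrite -(functional_adj hpsi); last exact: bounded_comp.
by rewrite adj_comp// adjK// adj_comp// adjK.
Qed.

Let bsand D X Y : bo D -> bo (adj (val Y) \o (D \o val X)).
Proof. by move=> bD; apply: bounded_comp (bav Y) _; exact: bounded_comp bD (bv X). Qed.

Lemma compression_form D X Y : bo D ->
  dot (theta D (iota X)) (iota Y) = psi (adj (val Y) \o (D \o val X)).
Proof. by move=> bD; rewrite compression_gns// project_vectorE//; exact: bounded_comp. Qed.

Lemma compression_bounded D : bo D -> bounded_operators (theta D).
Proof.
move=> bD; have bD' := bounded_adj bD; apply/bounded_operatorsP; split=> [c f g|].
  apply: gns_eqP => Y; rewrite (psdDl dotP) (psdZl dotP) !compressionE//.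
  by rewrite (psdDl dotP) (psdZl dotP).
have [C C0 DC] := bounded_op_bound bD'.
exists C => // f; apply: (@completion_norm_le _ _ _ hB).
  by rewrite mulr_ge0// form_norm_ge0.
move=> Y; rewrite -gns_dotr compressionE//.
apply: le_trans (psd_CauchySchwarz dotP _ _) _.
rewrite (mulrC C) -mulrA; apply: ler_wpM2l; first exact: form_norm_ge0.
by apply: le_trans (project_vector_norm_comp Y bD' C0 DC) _; rewrite /form_norm gns_dot.
Qed.

Lemma eq_on_gns_vectors (S T : L -> L) : bounded_operators S -> bounded_operators T ->
  (forall X Y, dot (S (iota X)) (iota Y) = dot (T (iota X)) (iota Y)) -> S = T.
Proof.
move=> bS bT ST; apply/funext => f; apply/eqP; rewrite -subr_eq0; apply/eqP.
apply: hilbert_norm_eq0; apply/ler_addgt0Pr => e e0; rewrite add0r.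
have bU := bounded_sub bS bT; have [C C0 UC] := bounded_op_bound bU.
have [d [d0 _ de]] := small_multiple C0 e0.
have [X fX] := gns_dense f d0.
have UX : (S - T) (iota X) = 0.
  by rewrite opDE opNE; apply/eqP; rewrite subr_eq0; apply/eqP/gns_eqP => Y; exact: ST.
have -> : S f - T f = (S - T) (f - iota X).
  by rewrite (bounded_opB _ _ bU) UX subr0.
apply: le_trans (UC _) _; apply: le_trans de; rewrite mulrC.
exact: ler_wpM2r.
Qed.

Lemma compressionP c S T : bo S -> bo T ->
  theta (c *: S + T) = c *: theta S + theta T.
Proof.
move=> bS bT; have bU := bounded_linear c bS bT.
apply: eq_on_gns_vectors; first exact: compression_bounded.
  by apply: bounded_linear; exact: compression_bounded.
move=> X Y; apply: (etrans (compression_form X Y bU)).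
apply/esym; apply: (etrans (hdot_opP c (theta S) (theta T) (iota X) (iota Y))).
rewrite (compression_form X Y bS) (compression_form X Y bT).
rewrite -(functionalP hpsi _ (bsand X Y bS) (bsand X Y bT)).
apply/esym.
congr psi; apply/funext => x.
exact: (bounded_opP c (S (val X x)) (T (val X x)) (bav Y)).
Qed.

Lemma compression_adjoint D D' : bo D -> is_adjoint D D' ->
  is_adjoint (theta D) (theta D').
Proof.
move=> bD DD'; rewrite -(adjE bD DD'); have bD' := bounded_adj bD.
have bt := compression_bounded bD.
suff <- : adj (theta D) = theta (adj D) by exact: adjP.
apply: eq_on_gns_vectors; [exact: bounded_adj|exact: compression_bounded|].
move=> X Y; rewrite (is_adjointC (adjP bt)) (psdC dotP) !compression_form//.
have bDY : bo (D \o val Y) by exact: bounded_comp.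
rewrite -(functional_adj hpsi); last exact: bounded_comp.
by rewrite adj_comp// adj_comp// adjK.
Qed.

Lemma compression_gns_mul D X (DX : V) : bo D -> D \o val X = val DX ->
  theta D (iota X) = iota DX.
Proof. by move=> bD e; rewrite compression_gns// e project_vector_val. Qed.

(** Multiplicativity holds when the right factor leaves [M] invariant, as no
    projection takes place between the two factors. *)
Lemma compression_comp D T : bo D -> M T -> (forall X, M (T \o val X)) ->
  theta (D \o T) = theta D \o theta T.
Proof.
move=> bD MT MTX; have bT := Mb MT.
apply: eq_on_gns_vectors.
- by apply: compression_bounded; exact: bounded_comp.
- by apply: bounded_comp; exact: compression_bounded.
move=> X Y; rewrite /= (@compression_gns_mul T X (in_subspace HM (MTX X)))//.
by rewrite !compression_form//; exact: bounded_comp.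
Qed.

Lemma compression_id : theta id = id.
Proof.
have bi := @bounded_id R H.
apply: eq_on_gns_vectors; [exact: compression_bounded|exact: bounded_id|].
by move=> X Y; rewrite compression_form// gns_dot.
Qed.

(** Transfers inequalities from the dense set of vectors of [M] to the whole GNS
    space. *)
Lemma form_dist_le (T : L -> L) (C d : R) f f' g g' :
  bounded_operators T -> operator_bound T C -> 0 <= C -> 0 <= d -> d <= 1 ->
  nrm (f - f') <= d -> nrm (g - g') <= d ->
  cmod (dot (T f) g - dot (T f') g') <= d * (C * (nrm f + nrm g + 1)).
Proof.
move=> bT TC C0 d0 d1 ff gg.
have -> : dot (T f) g - dot (T f') g' = dot (T (f - f')) g + dot (T f') (g - g').
  by rewrite bounded_opB// (psdBl dotP) (psdBr dotP) addrA subrK.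
have h1 : cmod (dot (T (f - f')) g) <= C * d * nrm g.
  apply: le_trans (psd_CauchySchwarz dotP _ _) _.
  apply: ler_wpM2r; first exact: form_norm_ge0.
  by apply: le_trans (TC _) _; exact: ler_wpM2l.
have f'1 : nrm f' <= nrm f + 1.
  apply: le_trans (form_norm_le_dist dotP f' f) _.
  by rewrite lerD2l (form_norm_distC dotP) (le_trans ff).
have h2 : cmod (dot (T f') (g - g')) <= C * (nrm f + 1) * d.
  apply: le_trans (psd_CauchySchwarz dotP _ _) _.
  apply: ler_pM => //; try exact: form_norm_ge0.
  by apply: le_trans (TC _) _; exact: ler_wpM2l.
apply: le_trans (cmodD _ _) _; lra.
Qed.

Lemma compression_numerical D (c : R) f : bo D ->
  (forall Y, Re (psi (adj (val Y) \o (D \o val Y))) <= c * Re (psi (adj (val Y) \o val Y))) ->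
  Re (dot (theta D f) f) <= c * nrm f ^+ 2.
Proof.
move=> bD Dc; have bi := @bounded_id R H.
pose T : H -> H := (- c)%:C *: id + D.
have bT : bo T by exact: bounded_linear.
have TE : theta T = (- c)%:C *: id + theta D by rewrite compressionP// compression_id.
have T0 Y : Re (dot (theta T (iota Y)) (iota Y)) <= 0.
  rewrite TE hdot_opP ReD Re_realM (compression_form _ _ bD) gns_dot.
  have := Dc Y; lra.
suff : Re (dot (theta T f) f) <= 0.
  rewrite TE hdot_opP ReD Re_realM (form_norm_sqr dotP).
  by lra.
have [C C0 TC] := bounded_op_bound (compression_bounded bT).
apply/ler_addgt0Pr => e e0; rewrite add0r.
have K0 : 0 <= C * (nrm f + nrm f + 1).
  by rewrite mulr_ge0// !addr_ge0 ?form_norm_ge0.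
have [d [d0 d1 de]] := small_multiple K0 e0.
have [Y fY] := gns_dense f d0.
have := form_dist_le (compression_bounded bT) TC C0 (ltW d0) d1 fY fY.
move=> /(le_trans (Re_le_cmod _)); rewrite ReB; have := T0 Y; lra.
Qed.

(** On vectors given by elements [X i] of [M], the quadratic form of the matrix
    is the value of [psi] at the operator sum of the [adj (X i) \o D i j \o X j],
    which is positive because the matrix [D] is. *)
Lemma compression_positive_mx n (D : 'I_n -> 'I_n -> H -> H) :
  (forall i j, bo (D i j)) -> positive_mx D -> positive_mx (fun i j => theta (D i j)).
Proof.
move=> bD Dpos x.
have E (y : 'I_n -> L) : dsum_dot (mx_operator (fun i j => theta (D i j)) y) y
    = \sum_i \sum_j dot (theta (D i j) (y j)) (y i).
  by apply: eq_bigr => i _; rewrite /mx_operator (psd_suml dotP).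
rewrite E; apply: ge0_approx => e e0.
have bnd i j : exists C : R, 0 <= C /\ operator_bound (theta (D i j)) C.
  by have [C C0 DC] := bounded_op_bound (compression_bounded (bD i j)); exists C.
have [C CP] : exists C : 'I_n -> 'I_n -> R, forall i j,
    0 <= C i j /\ operator_bound (theta (D i j)) (C i j).
  have [C' C'P] := choice (fun ij : 'I_n * 'I_n => bnd ij.1 ij.2).
  by exists (fun i j => C' (i, j)) => i j; exact: (C'P (i, j)).
pose K := \sum_i \sum_j C i j * (nrm (x j) + nrm (x i) + 1).
have K0 : 0 <= K.
  apply: sumr_ge0 => i _; apply: sumr_ge0 => j _; have [C0 _] := CP i j.
  by rewrite mulr_ge0// !addr_ge0 ?form_norm_ge0.
have [d [d0 d1 de]] := small_multiple K0 e0.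
have [X XP] := choice (fun i => gns_dense (x i) d0).
exists (\sum_i \sum_j dot (theta (D i j) (iota (X j))) (iota (X i))).
  have -> : \sum_i \sum_j dot (theta (D i j) (iota (X j))) (iota (X i))
      = psi (\sum_i \sum_j (adj (val (X i)) \o (D i j \o val (X j)))).
    rewrite (functional_sum hpsi); last first.
      by move=> i; apply: bounded_sum => j; exact: bsand.
    apply: eq_bigr => i _; rewrite (functional_sum hpsi).
      by apply: eq_bigr => j _; rewrite compression_form.
    by move=> j; exact: bsand.
  apply: hpsi.2.
    by apply: bounded_sum => i; apply: bounded_sum => j; exact: bsand.
  move=> h; have := Dpos (fun i => val (X i) h); congr (0 <= _).
  have Hp := @hdot_psd R H.
  rewrite !fct_sumE /dsum_dot (psd_suml Hp); apply: eq_bigr => i _.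
  rewrite fct_sumE /mx_operator !(psd_suml Hp); apply: eq_bigr => j _ /=.
  by rewrite (is_adjointC (adjP (bv (X i)))).
rewrite -sumrB; apply: le_trans de; rewrite mulr_sumr.
have tri (F : 'I_n -> R[i]) : cmod (\sum_i F i) <= \sum_i cmod (F i).
  apply: (big_ind2 (fun z r => cmod z <= r)) => [|z r z' r' h h'|//].
    by rewrite cmod0.
  by apply: le_trans (cmodD _ _) _; exact: lerD.
apply: le_trans (tri _) _; apply: ler_sum => i _.
rewrite -sumrB mulr_sumr; apply: le_trans (tri _) _; apply: ler_sum => j _.
have [C0 DC] := CP i j.
by apply: form_dist_le => //; [exact: compression_bounded|exact: ltW].
Qed.

End compression.

Arguments gns_vector {R H psi} hpsi {M} HM Mb _.
Arguments compression {R H psi} hpsi {M} HM Mb _ _.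
Arguments compression_numerical {R H psi} hpsi {M} HM Mb {D c} f _ _.
Arguments compression_adjoint {R H psi} hpsi {M} HM Mb {D D'} _ _.
Arguments compression_bounded {R H psi} hpsi {M} HM Mb {D} _.
Arguments gns_dense {R H psi} hpsi {M} HM Mb f {e} _.
Arguments gns_eqP {R H psi hpsi M HM Mb f g} _.


(** * Pure states have irreducible representations *)

Section irreducibility.
Context {R : realType} {H : hilbertType R}.
Local Notation bo := (@bounded_operators R H).
Variables (psi : (H -> H) -> R[i]) (hpsi : positive_functional psi).
Variables (M : set (H -> H)) (HM : is_subspace M) (Mb : M `<=` bo).
Hypotheses (Mmul : forall S T, M S -> M T -> M (S \o T))
  (Madj : forall T, M T -> M (adj T)) (Mid : M id) (psi1 : psi id = 1).
Local Notation V := (subspace_of HM).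
Local Notation L := (gns_space hpsi HM Mb).
Local Notation dot := (hdot L).
Local Notation dotP := (@hdot_psd R L).
Local Notation nrm := (form_norm (hdot L)).
Local Notation theta := (compression hpsi HM Mb).
Local Notation iota := (gns_vector hpsi HM Mb).
Implicit Types (D S T Z : H -> H) (X Y : V) (f g : L).

(** Such functionals are dominated by the numerical ranges of the GNS
    representation. Purity is tested against these, since the decompositions
    given by invariant subspaces are of this kind. *)
Definition in_numerical_range_of (g : V -> R) := forall X (c : R),
  (forall Y, Re (psi (adj (val Y) \o (val X \o val Y)))
             <= c * Re (psi (adj (val Y) \o val Y))) -> g X <= c.

Definition pure_on := forall (g1 g2 : V -> R) (r : R),
  real_linear g1 -> real_linear g2 -> 0 < r < 1 ->
  in_numerical_range_of g1 -> in_numerical_range_of g2 ->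
  (forall X, r * g1 X + (1 - r) * g2 X = Re (psi (val X))) ->
  forall X, g1 X = Re (psi (val X)).

Let bv X : bo (val X). Proof. by apply: Mb; exact: (subspaceP X). Qed.
Let one : V := in_subspace HM Mid.
Let xi : L := iota one.
Let thb X : bounded_operators (theta (val X)). Proof. exact: compression_bounded. Qed.

Let theta_xi X : theta (val X) xi = iota X.
Proof. exact: compression_gns_mul. Qed.

Let theta_val_linear (c : R[i]) X Y :
  theta (val (c *: X + Y)) = c *: theta (val X) + theta (val Y).
Proof.
by rewrite subspace_valP; exact: compressionP.
Qed.

Definition vector_state f X : R := Re (dot (theta (val X) f) f) / nrm f ^+ 2.

Lemma vector_state_linear f : real_linear (vector_state f).
Proof.
have lin (r : R) X Y : Re (dot (theta (val (r%:C *: X + Y)) f) f)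
    = r * Re (dot (theta (val X) f) f) + Re (dot (theta (val Y) f) f).
  by rewrite theta_val_linear hdot_opP ReD Re_realM.
have lin0 : Re (dot (theta (val (0 : V)) f) f) = 0.
  have := lin (-1) 0 0; rewrite scaler0 addr0; lra.
split=> [X Y|r X]; rewrite /vector_state.
  by rewrite -[X]scale1r lin mul1r scale1r mulrDl.
by rewrite -[_ *: X]addr0 lin lin0 addr0 mulrA.
Qed.

Lemma vector_state_range f : f != 0 -> in_numerical_range_of (vector_state f).
Proof.
move=> f0 X c Xc; rewrite ler_pdivrMr.
  exact: (compression_numerical hpsi HM Mb f (bv X) Xc).
rewrite exprn_gt0// lt_def form_norm_ge0 andbT; apply: contra_neq f0 => h.
by apply: hilbert_norm_eq0; rewrite h.
Qed.

(** Let [k] and [k'] be the components of the cyclic vector [xi] along an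
    invariant subspace [N] and its orthogonal. If one of them is zero, [N] is
    trivial. Otherwise the state is a convex combination of the vector states of
    [k] and [k'], so purity makes the vector state of [k] equal to [psi]; this
    forces [k] to be a multiple of [xi], and [xi] lies in [N]. *)
Lemma pure_irreducible : pure_on ->
  forall N : set L, is_subspace N -> closed N ->
    (forall X f, N f -> N (theta (val X) f)) -> N = [set 0] \/ N = setT.
Proof.
move=> pure N HN clN Ninv.
have [N0 NL] := HN.
have full : N xi -> N = setT.
  move=> Nxi; apply/seteqP; split=> // f _; apply: hilbert_closed clN _ => e e0.
  have e20 : 0 < e / 2 by rewrite divr_gt0.
  have [X fX] := gns_dense hpsi HM Mb f e20.
  exists (iota X); first by rewrite -theta_xi; exact: Ninv.
  by apply: le_lt_trans fX _; rewrite ltr_pdivrMr// ltr_pMr// ltr1n.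
pose adjV X : V := in_subspace HM (Madj (subspaceP X)).
have thadj X f g : dot (theta (val X) f) g = dot f (theta (val (adjV X)) g).
  exact: (compression_adjoint hpsi HM Mb (bv X) (adjP (bv X))).
have [k Nk kP] := orthogonal_projection xi HN clN.
have xiE : xi = k + (xi - k) by rewrite addrC subrK.
move: (xi - k) xiE kP => k' xiE kP.
have [k0|k0] := eqVneq k 0.
  left; apply/seteqP; split=> [f Nf|_ ->//] /=.
  apply: gns_eqP => X.
  rewrite (psd0l dotP) -theta_xi (psdC dotP) thadj.
  have := kP _ (Ninv (adjV X) _ Nf); rewrite xiE k0 add0r => ->.
  by rewrite rmorph0.
right; have [k'0|k'0] := eqVneq k' 0.
  by apply: full; rewrite xiE k'0 addr0.
have pos f : f != 0 -> 0 < nrm f ^+ 2.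
  move=> f0; rewrite exprn_gt0// lt_def form_norm_ge0 andbT.
  by apply: contra_neq f0 => h; apply: hilbert_norm_eq0; rewrite h.
have cross1 X : dot (theta (val X) k) k' = 0.
  by rewrite (psdC dotP) kP ?rmorph0//; exact: Ninv.
have cross2 X : dot (theta (val X) k') k = 0.
  by rewrite thadj kP//; exact: Ninv.
have split_state X : Re (psi (val X)) =
    Re (dot (theta (val X) k) k) + Re (dot (theta (val X) k') k').
  have -> : psi (val X) = dot (theta (val X) xi) xi.
    by rewrite theta_xi gns_dot /= adj_id.
  have -> : dot (theta (val X) xi) xi = dot (theta (val X) (k + k')) (k + k').
    by rewrite -xiE.
  rewrite (bounded_opD k k' (thb X)) (psdDl dotP) !(psdDr dotP).
  by rewrite cross1 cross2 addr0 add0r ReD.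
have kk' : nrm k ^+ 2 + nrm k' ^+ 2 = 1.
  have := split_state one; rewrite /= psi1 compression_id//.
  by rewrite !(form_norm_sqr dotP).
have := pos _ k0; have := pos _ k'0 => k'pos kpos.
have state X : vector_state k X = Re (psi (val X)).
  apply: (pure (vector_state k) (vector_state k') (nrm k ^+ 2)).
  - exact: vector_state_linear.
  - exact: vector_state_linear.
  - by rewrite kpos -kk' ltrDl.
  - exact: vector_state_range.
  - exact: vector_state_range.
  - move=> Y; rewrite split_state -kk' addrAC subrr add0r /vector_state.
    by rewrite !mulrA ![_ ^+ 2 * _]mulrC !mulfK ?gt_eqF.
have kxi : k = (nrm k ^+ 2)%:C *: xi.
  apply: gns_eqP => X.
  have re Y : Re (dot (iota Y) k) = Re (dot (iota Y) ((nrm k ^+ 2)%:C *: xi)).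
    rewrite (psdZr dotP) conjr Re_realM.
    have -> : Re (dot (iota Y) xi) = vector_state k Y by rewrite state gns_dot /= adj_id.
    rewrite /vector_state mulrC mulfVK ?gt_eqF//.
    have -> : dot (iota Y) k = dot (theta (val Y) (k + k')) k by rewrite -xiE theta_xi.
    by rewrite (bounded_opD k k' (thb Y)) (psdDl dotP) cross2 addr0.
  rewrite (psdC dotP _ k) (psdC dotP _ (_ *: _)); congr Num.conj.
  apply: eq_ReIm => //; have := re ('i *: X).
  have -> : iota ('i *: X) = 'i *: iota X.
    apply: gns_eqP => Y.
    rewrite (psdZl dotP) !gns_dot -(functionalZ hpsi); last first.
      by apply: bounded_comp => //; exact: bounded_adj.
    rewrite subspace_valZ; congr psi; apply/funext => x.
    exact: (bounded_opZ 'i (val X x) (bounded_adj (bv Y))).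
  by rewrite !(psdZl dotP) !Re_iM => /oppr_inj.
apply: full.
have -> : xi = (nrm k ^+ 2)^-1%:C *: k.
  by rewrite {2}kxi scalerA -rmorphM mulVf ?gt_eqF// scale1r.
by have := NL (nrm k ^+ 2)^-1%:C k 0 Nk N0; rewrite addr0.
Qed.

End irreducibility.


(** * States that peak at a self-adjoint operator *)

(** The complex functional with real part [h]. *)
Lemma complexification_linear (R : realType) (E : lmodType R[i]) (h : E -> R) :
  real_linear h -> forall (c : R[i]) x y,
  Complex (h (c *: x + y)) (- h ('i *: (c *: x + y)))
  = c * Complex (h x) (- h ('i *: x)) + Complex (h y) (- h ('i *: y)).
Proof.
move=> hl; have hZ (c : R[i]) x : h (c *: x) = Re c * h x + Im c * h ('i *: x).
  have -> : c *: x = (Re c)%:C *: x + (Im c)%:C *: ('i *: x).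
    by rewrite scalerA -scalerDl [_ * 'i]mulrC -complexE.
  by rewrite hl.1 !hl.2.
move=> c x y; rewrite scalerDr !hl.1 scalerA (hZ c) (hZ ('i * c)).
case: c => a b; apply: eq_ReIm => /=; ring.
Qed.

Section peaking.
Context {R : realType} {H : hilbertType R}.
Local Notation bo := (@bounded_operators R H).
Local Notation dotP := (@hdot_psd R H).
Local Notation w := (@numerical_sup R H).
Variables (x0 : H) (x0N0 : x0 != 0).
Variables (M : set (H -> H)) (HM : is_subspace M) (Mb : M `<=` bo).
Local Notation V := (subspace_of HM).
Implicit Types (S T : H -> H) (X Y : V) (r l m : R).
Variables (a : H -> H) (ba : bo a).

Let bv X : bo (val X). Proof. by apply: Mb; exact: (subspaceP X). Qed.

(** Domination on [M] by the support functional of the states of value [w a] at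
    [a]. *)
Definition peaks_at (g : V -> R) := forall X l, 0 <= l ->
  g X <= w (val X + l%:C *: a) - l * w a.

(** An extreme point of the set of restrictions to [M] of the states of largest
    value at [a], extended to all bounded operators within this set of
    states. *)
Lemma peak_functional : exists psi : (H -> H) -> R[i],
  [/\ positive_functional psi, psi id = 1,
      forall T l, bo T -> 0 <= l -> Re (psi T) <= w (T + l%:C *: a) - l * w a &
      forall g1 g2 r, real_linear g1 -> real_linear g2 -> 0 < r < 1 ->
        peaks_at g1 -> peaks_at g2 ->
        (forall X, r * g1 X + (1 - r) * g2 X = Re (psi (val X))) ->
        forall X, g1 X = Re (psi (val X))].
Proof.
pose E := subspace_of (@bounded_subspace R H).
pose p (T : E) : R := w (val T).
have be (T : E) : bo (val T) by exact: (subspaceP T).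
have hp : sublinear p.
  split=> [S T|r T r0]; rewrite /p.
    by rewrite subspace_valD; exact: (numerical_supD x0N0 (be S) (be T)).
  by rewrite subspace_valZ; exact: (numerical_supZ x0N0 (be T) r0).
pose aE : E := in_subspace _ ba.
pose q := exposed_face p aE.
have hq : sublinear q by exact: exposed_face_sublinear.
have qp : dominated q p by exact: exposed_face_dominated.
pose i (X : V) : E := in_subspace _ (bv X).
have iD X Y : i (X + Y) = i X + i Y.
  apply: val_inj; rewrite subspace_valD -[LHS]/(val (X + Y)) -[RHS]/(val X + val Y).
  exact: raddfD.
have iZ r X : i (r%:C *: X) = r%:C *: i X.
  apply: val_inj; rewrite subspace_valZ -[LHS]/(val (r%:C *: X)) -[RHS]/(r%:C *: val X).
  exact: linearZ.
have hqi : sublinear (fun X => q (i X)).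
  by split=> [X Y|r X r0]; rewrite ?iD ?iZ; [exact: hq.1|exact: hq.2].
have [g [glin gq gext]] := extreme_functional hqi.
have [h [hlin hdom hi]] := dominated_extension iD iZ hq glin gq.
have hp' (T : E) : h T <= p T by exact: le_trans (hdom T) (qp T).
pose psi T : R[i] := if pselect (bo T) is left b
  then Complex (h (in_subspace _ b)) (- h ('i *: (in_subspace _ b : E))) else 0.
have psiE (T : E) : psi (val T) = Complex (h T) (- h ('i *: T)).
  rewrite /psi; case: pselect => [b|/(_ (be T))//].
  by have -> : in_subspace _ b = T by exact: val_inj.
have Re_psi T (bT : bo T) : Re (psi T) = h (in_subspace _ bT).
  by rewrite -[T in psi T]/(val (in_subspace (@bounded_subspace R H) bT)) psiE.
have h_le0 (T : E) : (forall x, Re (hdot H (val T x) x) <= 0) -> h T <= 0.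
  move=> T0; apply: le_trans (hp' T) _; apply: (numerical_sup_le x0N0) => x.
  by rewrite mul0r.
have hI (T : E) : (forall x, Im (hdot H (val T x) x) = 0) -> h ('i *: T) = 0.
  move=> T0; apply/le_anti/andP; split.
    by apply: h_le0 => x; rewrite subspace_valZ opZE (psdZl dotP) Re_iM T0 oppr0.
  rewrite -oppr_le0 -(real_linearN _ hlin); apply: h_le0 => x.
  by rewrite subspace_valN opNE subspace_valZ opZE (psdNl dotP) (psdZl dotP) ReN Re_iM T0 !oppr0.
have psilin (c : R[i]) S T : bo S -> bo T -> psi (c *: S + T) = c * psi S + psi T.
  move=> bS bT; rewrite -[S]/(val (in_subspace (@bounded_subspace R H) bS)).
  rewrite -[T]/(val (in_subspace (@bounded_subspace R H) bT)) -subspace_valP !psiE.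
  exact: complexification_linear.
have psipos : positive_functional psi.
  split=> // T bT T0; rewrite -[T]/(val (in_subspace (@bounded_subspace R H) bT)) psiE.
  rewrite ge0_ReIm /= hI ?oppr0 ?eqxx/=; last first.
    by move=> x; have := T0 x; rewrite ge0_ReIm => /andP[/eqP].
  rewrite -oppr_le0 -(real_linearN _ hlin); apply: h_le0 => x.
  rewrite subspace_valN opNE (psdNl dotP) ReN oppr_le0 /=.
  by have := T0 x; rewrite ge0_ReIm => /andP[].
pose idE : E := in_subspace _ (@bounded_id R H).
have psi1 : psi id = 1.
  rewrite -[X in psi X]/(val idE) psiE hI ?oppr0; last first.
    by move=> x; rewrite /= (psdE dotP).
  congr Complex; apply/le_anti/andP; split.
    by have := hp' idE; rewrite /p -[val idE]scale1r -[1]/(1%:C) (numerical_sup_scalar x0N0).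
  have := hp' (- idE); rewrite (real_linearN _ hlin) /p subspace_valN -scaleN1r.
  have -> : (- 1 : R[i]) = (- 1)%:C by rewrite rmorphN1.
  by rewrite (numerical_sup_scalar x0N0) lerN2.
exists psi; split=> //.
- move=> T l bT l0; rewrite Re_psi; apply: le_trans (hdom _) _.
  have := exposed_face_le hp aE (in_subspace _ bT) l0.
  by rewrite /p subspace_valD subspace_valZ.
- move=> g1 g2 r g1l g2l r01 g1p g2p g12 X.
  have psig Y : Re (psi (val Y)) = g Y by rewrite (Re_psi _ (bv Y)) hi.
  have dom g' : peaks_at g' -> dominated g' (fun X => q (i X)).
    move=> g'p Y; apply: exposed_face_ge => l l0.
    by rewrite /p subspace_valD subspace_valZ; exact: g'p.
  rewrite psig; apply: gext g1l g2l (dom _ g1p) (dom _ g2p) r01 _ X => Y.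
  by rewrite g12 psig.
Qed.

End peaking.


(** * Purity of peaking states *)

Lemma convex_combination_max (R : realType) (r u v m : R) : 0 < r < 1 -> v <= m ->
  m <= r * u + (1 - r) * v -> m <= u.
Proof. move=> /andP[r0 r1] vm h; nra. Qed.

Section peaking_criteria.
Context {R : realType} {H : hilbertType R}.
Local Notation bo := (@bounded_operators R H).
Local Notation dotP := (@hdot_psd R H).
Local Notation nrm := (form_norm (hdot H)).
Local Notation w := (@numerical_sup R H).
Variables (x0 : H) (x0N0 : x0 != 0).
Variables (M : set (H -> H)) (HM : is_subspace M) (Mb : M `<=` bo).
Hypotheses (Madj : forall T, M T -> M (adj T)) (Mid : M id).
Local Notation V := (subspace_of HM).
Implicit Types (S T : H -> H) (X Y : V) (r l m : R).
Variables (a : H -> H) (ba : bo a) (sa : selfadjoint a).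
Variables (psi : (H -> H) -> R[i]) (hpsi : positive_functional psi) (psi1 : psi id = 1).
Hypothesis psi_le : forall T l, bo T -> 0 <= l ->
  Re (psi T) <= w (T + l%:C *: a) - l * w a.

Let bv X : bo (val X). Proof. by apply: Mb; exact: (subspaceP X). Qed.
Let bav X : bo (adj (val X)). Proof. by apply: bounded_adj. Qed.
Let bi : bo id. Proof. exact: bounded_id. Qed.

Let w0 : w 0 = 0.
Proof.
apply/le_anti/andP; split.
  by apply: (numerical_sup_le x0N0) => x; rewrite op0E (psd0l dotP) mul0r.
have := numerical_supD x0N0 (@bounded_zero R H) (@bounded_zero R H).
rewrite addr0; lra.
Qed.

Lemma peak_functional_ge : w a <= Re (psi a).
Proof.
have := psi_le (bounded_opp ba) ler01.
rewrite scale1r addNr w0 (functionalN hpsi ba) ReN; lra.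
Qed.

Lemma numerical_le S T : bo S -> bo T -> (forall x, Re (hdot H (S x) x) <= Re (hdot H (T x) x)) ->
  w (S - T) <= 0.
Proof.
move=> bS bT ST; apply: (numerical_sup_le x0N0) => x.
by rewrite opDE opNE (psdBl dotP) ReB mul0r subr_le0.
Qed.

(** Since [b] is positive, [adj b \o b] is at most a multiple of [b], so [psi]
    vanishes there too; the Cauchy-Schwarz inequality does the rest. *)
Lemma functional_vanish_right b T : bo b -> positive_operator b -> selfadjoint b ->
  psi b = 0 -> bo T -> psi (T \o b) = 0.
Proof.
move=> bb b0 sb psib bT.
have F : psd_form (fun x y => hdot H (b x) y).
  split=> [c u v y|u v|u].
  - by rewrite bounded_opP// (psdDl dotP) (psdZl dotP).
  - by rewrite sb (psdC dotP).
  - exact: b0.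
have [C C0 bC] := bounded_op_bound bb.
have b2 : Re (psi (adj b \o b)) <= Re (psi (C%:C *: b)).
  apply: (functional_mono hpsi).
  - by apply: bounded_comp => //; exact: bounded_adj.
  - exact: bounded_scale.
  move=> x; rewrite opZE (psdZl dotP) Re_realM /= (is_adjointC (adjP bb)).
  have := psd_CauchySchwarz_Re F x (b x); rewrite /=.
  have := psd_CauchySchwarz_Re dotP (b (b x)) (b x).
  have := bC (b x); have := form_norm_ge0 (hdot H) (b x).
  rewrite -[Re (hdot H (b x) x)](form_norm_sqr F) -(form_norm_sqr dotP (b x)).
  rewrite -[Re (hdot H (b (b x)) (b x))](form_norm_sqr F).
  have := form_norm_ge0 (fun x y => hdot H (b x) y) x.
  have := form_norm_ge0 (fun x y => hdot H (b x) y) (b x).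
  set p := form_norm _ x; set s := form_norm _ (b x); set n := form_norm _ (b x).
  move=> s0 p0; rewrite le_eqVlt => /predU1P[<-|n0] h1 h2 h3.
    by rewrite expr0n mulr_ge0 ?sqr_ge0.
  have h4 : s ^+ 2 <= C * n ^+ 2.
    by apply: le_trans h2 _; rewrite expr2 mulrA ler_wpM2r// ltW.
  have h5 : (n ^+ 2) ^+ 2 <= p ^+ 2 * s ^+ 2.
    by rewrite -exprMn ler_pXn2r// nnegrE ?sqr_ge0// mulr_ge0.
  rewrite -(ler_pM2r (exprn_gt0 2 n0)) -expr2; apply: le_trans h5 _.
  by have := ler_wpM2l (sqr_ge0 p) h4; lra.
have : cmod (psi (T \o b)) <= 0.
  have := functional_CauchySchwarz hpsi bb (bounded_adj bT).
  rewrite adjK// => h; apply: le_trans h _.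
  have -> : Num.sqrt (Re (psi (adj b \o b))) = 0.
    apply: ler0_sqrtr; apply: le_trans b2 _.
    by rewrite (functionalZ hpsi _ bb) psib mulr0.
  by rewrite mul0r.
by move=> h; apply: cmod_eq0; apply/eqP; rewrite eq_le h cmod_ge0.
Qed.

(** The operator [b = w a - a] is positive and [psi b = 0]. As it commutes with
    [Y], the value of [psi] at [adj Y \o b \o Y] is its value at
    [(adj Y \o Y) \o b], which is zero: the vector state of [Y] peaks at [a]
    too. *)
Lemma commuting_peaks (g : V -> R) : (forall X, a \o val X = val X \o a) ->
  in_numerical_range_of psi g -> peaks_at a g.
Proof.
move=> comm gX X l l0; apply: gX => Y.
pose b : H -> H := (w a)%:C *: id - a.
have bb : bo b by apply: bounded_sub ba; exact: bounded_scale.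
have sb : selfadjoint b.
  move=> x y; rewrite /b !opDE !opNE !opZE (psdBl dotP) (psdBr dotP) (psdZl dotP) (psdZr dotP).
  by rewrite conjr sa.
have b0 : positive_operator b.
  move=> x; rewrite (selfadjoint_form_real sb) ler0c /b opDE opNE opZE.
  rewrite (psdBl dotP) (psdZl dotP) ReB Re_realM -(form_norm_sqr dotP) subr_ge0.
  exact: numerical_sup_ub.
have psib : psi b = 0.
  apply/le_anti; rewrite hpsi.2// andbT lecE /=.
  have := hpsi.2 _ bb b0; rewrite ge0_ReIm => /andP[/eqP-> _]; rewrite eqxx /=.
  rewrite /b (functionalB hpsi) ?(functionalZ hpsi)//; last exact: bounded_scale.
  by rewrite psi1 mulr1 ReB /= subr_le0; exact: peak_functional_ge.
pose Z := adj (val Y) \o val Y.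
have bZ : bo Z by exact: bounded_comp (bav Y) (bv Y).
have bYa : bo (adj (val Y) \o (a \o val Y)).
  by apply: bounded_comp (bav Y) _; exact: bounded_comp ba (bv Y).
have bYX : bo (adj (val Y) \o (val X \o val Y)).
  by apply: bounded_comp (bav Y) _; exact: bounded_comp (bv X) (bv Y).
have ZA : adj (val Y) \o (a \o val Y) = (w a)%:C *: Z - (Z \o b).
  have bE y : b y = (w a)%:C *: y - a y by [].
  apply/funext => x; rewrite -[LHS]/(adj (val Y) (a (val Y x))).
  rewrite -[RHS]/((w a)%:C *: adj (val Y) (val Y x) - adj (val Y) (val Y (b x))) bE.
  have -> : a (val Y x) = val Y (a x) by exact: (congr1 (fun f => f x) (comm Y)).
  rewrite (bounded_opB _ _ (bv Y)) (bounded_opZ _ _ (bv Y)).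
  by rewrite (bounded_opB _ _ (bav Y)) (bounded_opZ _ _ (bav Y)) subKr.
have psiA : Re (psi (adj (val Y) \o (a \o val Y))) = w a * Re (psi Z).
  rewrite ZA (functionalB hpsi); [|exact: bounded_scale|exact: bounded_comp].
  by rewrite (functional_vanish_right bb b0 sb psib bZ) subr0 (functionalZ hpsi _ bZ) Re_realM.
have bS : bo (val X + l%:C *: a) by apply: bounded_add => //; exact: bounded_scale.
have := functional_mono hpsi
  (bounded_add bYX (bounded_scale l%:C bYa)) (bounded_scale (w (val X + l%:C *: a))%:C bZ).
rewrite (functionalD hpsi bYX (bounded_scale _ bYa)) (functionalZ hpsi _ bYa).
rewrite (functionalZ hpsi _ bZ) ReD !Re_realM psiA => h.
rewrite mulrBl lerBrDr -mulrA; apply: h => x.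
rewrite opDE !opZE (psdDl dotP) !(psdZl dotP) ReD !Re_realM /=.
rewrite !(is_adjointC (adjP (bv Y))) -(form_norm_sqr dotP).
have := numerical_sup_ub (val Y x) bS.
by rewrite opDE opZE (psdDl dotP) (psdZl dotP) ReD Re_realM.
Qed.

(** For [l > 0], domination at [X] and [l] says that [g1] is at least [w a] at
    [b = (c - X) / l], where [c] is the numerical supremum of [X + l a]; this
    [b] lies above [a]. The element [b'] between [a] and [b] has numerical
    supremum at most [w a], and [psi] attains [w a] there, so both [g1] and [g2]
    do; finally [g1 b >= g1 b']. *)
Lemma unperforated_peaks (g1 g2 : V -> R) r :
  opnorm a <= w a ->
  (forall b, M b -> selfadjoint b -> le_operator a b -> exists b',
     [/\ M b', selfadjoint b', opnorm b' <= opnorm a, le_operator a b' & le_operator b' b]) ->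
  real_linear g1 -> real_linear g2 -> 0 < r < 1 ->
  in_numerical_range_of psi g1 -> in_numerical_range_of psi g2 ->
  (forall X, r * g1 X + (1 - r) * g2 X = Re (psi (val X))) ->
  peaks_at a g1.
Proof.
move=> na unp g1l g2l r01 g1n g2n g12.
have range_le (g : V -> R) X : in_numerical_range_of psi g -> g X <= w (val X).
  apply=> Y; have bYX : bo (adj (val Y) \o (val X \o val Y)).
    by apply: bounded_comp (bav Y) _; exact: bounded_comp (bv X) (bv Y).
  have bZ : bo (adj (val Y) \o val Y) by exact: bounded_comp (bav Y) (bv Y).
  rewrite -Re_realM -(functionalZ hpsi _ bZ); apply: (functional_mono hpsi) => //.
    exact: bounded_scale.
  move=> x; rewrite opZE (psdZl dotP) Re_realM /= !(is_adjointC (adjP (bv Y))).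
  by rewrite -(form_norm_sqr dotP); exact: (numerical_sup_ub _ (bv X)).
move=> X l; rewrite le_eqVlt => /predU1P[<-|l0].
  by rewrite scale0r addr0 mul0r subr0; exact: range_le.
set c := w (val X + l%:C *: a).
pose adjX : V := in_subspace HM (Madj (subspaceP X)).
pose one : V := in_subspace HM Mid.
(* [b] has to be self-adjoint, hence is built from the real part of [X]. *)
pose ReX : V := (2^-1)%:C *: (X + adjX).
have ReXE x y : hdot H (val ReX x) y = (2^-1)%:C * (hdot H (val X x) y + hdot H (adj (val X) x) y).
  by rewrite subspace_valZ subspace_valD opZE opDE (psdZl dotP) (psdDl dotP).
have sReX : selfadjoint (val ReX).
  move=> x y; rewrite ReXE (psdC dotP (val ReX y) x) ReXE conj_mul conjr conj_add.
  by rewrite -!(psdC dotP) (adjP (bv X)) (is_adjointC (adjP (bv X))) addrC.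
have formReX x : Re (hdot H (val ReX x) x) = Re (hdot H (val X x) x).
  rewrite ReXE Re_realM ReD (is_adjointC (adjP (bv X))) (psdC dotP (val X x) x) Re_conjC.
  by field.
pose bV : V := (l^-1)%:C *: (c%:C *: one - ReX).
have bE x y : hdot H (val bV x) y = (l^-1)%:C * (c%:C * hdot H x y - hdot H (val ReX x) y).
  rewrite subspace_valZ subspace_valB subspace_valZ opZE opDE opNE opZE.
  by rewrite (psdZl dotP) (psdBl dotP) (psdZl dotP).
have sbV : selfadjoint (val bV).
  move=> x y; rewrite bE (psdC dotP (val bV y) x) bE conj_mul conjr conj_sub conj_mul conjr.
  by rewrite -!(psdC dotP) sReX.
have real_pos T : selfadjoint T -> (forall x, 0 <= Re (hdot H (T x) x)) -> positive_operator T.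
  by move=> sT T0 x; rewrite (selfadjoint_form_real sT) ler0c.
have sB S T : selfadjoint S -> selfadjoint T -> selfadjoint (S - T).
  move=> sS sT x y; rewrite !opDE !opNE (psdBl dotP) (psdBr dotP).
  by rewrite sS sT.
have le_ab : le_operator a (val bV).
  apply: real_pos; first exact: sB.
  move=> x; rewrite opDE opNE (psdBl dotP) ReB subr_ge0 bE Re_realM ReB Re_realM formReX.
  rewrite ler_pdivlMl// -(form_norm_sqr dotP) lerBrDl.
  have bS : bo (val X + l%:C *: a) by apply: bounded_add => //; exact: bounded_scale.
  have := numerical_sup_ub x bS.
  by rewrite opDE opZE (psdDl dotP) (psdZl dotP) ReD Re_realM.
have [b' [Mb' sb' nb' ab' b'b]] := unp _ (subspaceP bV) sbV le_ab.
pose b'V : V := in_subspace HM Mb'.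
have bb' : bo b' by exact: Mb.
have le_form S T : le_operator S T -> forall x, Re (hdot H (S x) x) <= Re (hdot H (T x) x).
  move=> ST x; have := ST x; rewrite opDE opNE (psdBl dotP) ge0_ReIm => /andP[_].
  by rewrite ReB subr_ge0.
have gb' g : in_numerical_range_of psi g -> g b'V <= w a.
  move=> /(range_le _ b'V) h; apply: le_trans h _; apply: le_trans na; apply: le_trans nb'.
  by apply: (numerical_sup_le x0N0) => x; exact: (bounded_form_le x bb').
have psib' : w a <= Re (psi b').
  have := psi_le (bounded_opp bb') ler01.
  rewrite scale1r mul1r (functionalN hpsi bb') ReN [- b' + a]addrC => h.
  have := le_trans h (lerB (numerical_le ba bb' (le_form _ _ ab')) (lexx (w a))).
  by rewrite sub0r lerN2.
have g1b' : w a <= g1 b'V.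
  apply: convex_combination_max r01 (gb' _ g2n) _.
  by rewrite g12; exact: psib'.
have g1b : g1 b'V <= g1 bV.
  rewrite -subr_le0 -(real_linearB _ _ g1l); apply: le_trans (range_le _ _ g1n) _.
  by rewrite subspace_valB; apply: (numerical_le bb' (bv bV)); exact: le_form.
have g1c : g1 (c%:C *: one) <= c.
  apply: le_trans (range_le _ _ g1n) _.
  by rewrite subspace_valZ (numerical_sup_scalar x0N0).
have g1X : g1 X <= g1 ReX.
  rewrite -subr_le0 -(real_linearB _ _ g1l); apply: le_trans (range_le _ _ g1n) _.
  by rewrite subspace_valB; apply: (numerical_le (bv X) (bv ReX)) => x; rewrite formReX.
have : w a <= l^-1 * (g1 (c%:C *: one) - g1 ReX).
  by apply: le_trans g1b' _; apply: le_trans g1b _; rewrite g1l.2 (real_linearB _ _ g1l).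
rewrite ler_pdivlMl// => h; apply: le_trans g1X _.
by rewrite lerBrDr; apply: le_trans g1c; rewrite -lerBrDl.
Qed.

End peaking_criteria.


(** * Representations and completely positive maps *)

(** The operator ['i *: (T - adj T)] is self-adjoint with zero numerical range,
    hence zero. *)
Lemma real_form_selfadjoint (R : realType) (H : hilbertType R) (T : H -> H) :
  bounded_operators T -> (forall x, Im (hdot H (T x) x) = 0) -> selfadjoint T.
Proof.
move=> bT T0; have dotP := @hdot_psd R H; have bT' := bounded_adj bT.
have aT := adjP bT; have aT' := is_adjointC aT.
pose D := 'i *: (T - adj T).
have bD : bounded_operators D by apply: bounded_scale; exact: bounded_sub.
have sD : selfadjoint D.
  move=> x y; rewrite /D !opZE !opDE !opNE (psdZl dotP) (psdBl dotP) (psdZr dotP) (psdBr dotP).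
  by rewrite aT aT' conji; ring.
have nD : opnorm D <= 0.
  apply: (selfadjoint_opnorm_le bD sD (lexx 0)) => x.
  rewrite mul0r /D opZE opDE opNE (psdZl dotP) (psdBl dotP) aT' (psdC dotP (T x) x).
  by rewrite Re_iM ImD ImN Im_conjC T0 !oppr0 addr0 oppr0 normr0.
suff TE : T = adj T by rewrite /selfadjoint {2}TE.
apply/funext => x.
have : D x = 0.
  apply: hilbert_norm_eq0; apply: le_trans (opnorm_bound bD x) _.
  by rewrite -(mul0r (form_norm (hdot H) x)) ler_wpM2r ?form_norm_ge0.
rewrite /D opZE opDE opNE => /eqP; rewrite scaler_eq0 subr_eq0 => /orP[|/eqP//].
by rewrite eq_complex /= oner_eq0 andbF.
Qed.

Section representations.
Context {R : realType} {K H : hilbertType R}.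
Variables (A : set (K -> K)) (HA : is_subspace A) (Ab : A `<=` @bounded_operators R K)
  (Acomp : forall S T, A S -> A T -> A (S \o T))
  (Aadj : forall T, A T -> A (adj T)) (Aid : A id).
Implicit Types (S T : K -> K) (f : (K -> K) -> (H -> H)).

Lemma linear_map_onP f c S T : linear_map_on A f -> A S -> A T ->
  f (c *: S + T) = c *: f S + f T.
Proof. by case=> _; apply. Qed.

Lemma linear_map_on0 f : linear_map_on A f -> f 0 = 0.
Proof.
move=> fl; have [A0 _] := HA.
by have := linear_map_onP (-1) fl A0 A0; rewrite scaler0 addr0 scaleN1r addNr.
Qed.

Lemma linear_map_onN f T : linear_map_on A f -> A T -> f (- T) = - f T.
Proof.
move=> fl AT; have [A0 _] := HA; have := linear_map_onP (-1) fl AT A0.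
by rewrite !scaleN1r linear_map_on0// !addr0.
Qed.

(** Positivity of [f], read off from 1 x 1 matrices, is applied to the sum of [T]
    and a multiple of the identity; the quadratic form of [f T] is then real. *)
Lemma completely_positive_selfadjoint f T : completely_positive A f ->
  A T -> selfadjoint T -> selfadjoint (f T).
Proof.
move=> [fl fcp] AT sT; have fb := fl.1; have bT := Ab AT.
pose S : K -> K := (opnorm T)%:C *: id + T.
have AS : A S by have [_ +] := HA; apply.
have pos (X : hilbertType R) (U : X -> X) :
    positive_mx (fun _ _ : 'I_1 => U) <-> positive_operator U.
  have E (x : 'I_1 -> X) : dsum_dot (mx_operator (fun _ _ : 'I_1 => U) x) x
      = hdot X (U (x ord0)) (x ord0).
    by rewrite /dsum_dot big_ord1 /mx_operator big_ord1.
  split=> [h x|h x]; last by rewrite E.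
  by have := h (fun _ => x); rewrite E.
have S0 : positive_operator S by exact: selfadjoint_shift_positive.
have fS0 : positive_operator (f S).
  by apply/pos; apply: fcp => //; exact/pos.
have fI0 : positive_operator (f id).
  apply/pos; apply: fcp => //; apply/pos => x.
  exact: (psd_ge0 hdot_psd).
apply: real_form_selfadjoint; first exact: fb.
move=> x; have := fS0 x; have := fI0 x.
rewrite /S (linear_map_onP _ fl Aid AT) hdot_opP !ge0_ReIm ImD Im_realM.
by move=> /andP[/eqP-> _] /andP[/eqP + _]; rewrite mulr0 add0r.
Qed.

Lemma linear_maps_eq_selfadjoint f g : linear_map_on A f -> linear_map_on A g ->
  (forall T, A T -> selfadjoint T -> f T = g T) -> forall T, A T -> f T = g T.
Proof.
move=> fl gl fg T AT; have [A0 AL] := HA.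
have kP := @hdot_psd R K; have aT := adjP (Ab AT); have aT' := is_adjointC aT.
have AZ c U : A U -> A (c *: U) by move=> AU; rewrite -[_ *: _]addr0; exact: AL.
pose U1 := (2^-1)%:C *: (T + adj T).
pose U2 := (2^-1)%:C *: ('i *: (adj T - T)).
have AU1 : A U1 by apply: (AZ); rewrite -[T in T + _]scale1r; apply: (AL) => //; exact: Aadj.
have AU2 : A U2.
  by do 2 apply: (AZ); rewrite addrC -scaleN1r; apply: (AL) => //; exact: Aadj.
have sU1 : selfadjoint U1.
  move=> x y; rewrite /U1 !opZE !opDE (psdZl kP) (psdZr kP) conjr (psdDl kP) (psdDr kP).
  by rewrite aT aT' addrC.
have sU2 : selfadjoint U2.
  move=> x y; rewrite /U2 !opZE !opDE !opNE !(psdZl kP) !(psdZr kP) conjr conji.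
  by rewrite (psdBl kP) (psdBr kP) aT aT'; ring.
have -> : T = 'i *: U2 + U1.
  have half : (2^-1)%:C + (2^-1)%:C = 1 :> R[i].
    by rewrite -rmorphD -[RHS](rmorph1 (real_complex R)); congr (_ %:C); field.
  have ii : 'i * (2^-1)%:C * 'i = - (2^-1)%:C :> R[i].
    by rewrite mulrAC -expr2 sqr_i mulN1r.
  rewrite /U1 /U2 !scalerA ii scaleNr -scalerN opprB -scalerDr addrACA addNr addr0.
  by rewrite scalerDr -scalerDl half scale1r.
by rewrite !linear_map_onP// !fg.
Qed.

Section image.
Variables (pi : (K -> K) -> (H -> H)) (pi_rep : star_representation A pi)
  (pi_unital : pi id = id).
Local Notation M := (pi @` A).

Lemma image_subspace : is_subspace M.
Proof.
have [pl _ _] := pi_rep; have [A0 AL] := HA; split.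
  by exists 0 => //; exact: linear_map_on0.
move=> c _ _ [S AS <-] [T AT <-]; exists (c *: S + T); first exact: AL.
exact: linear_map_onP.
Qed.

Lemma image_bounded : M `<=` @bounded_operators R H.
Proof. by have [[pb _] _ _] := pi_rep => _ [T AT <-]; exact: pb. Qed.

Lemma representation_adj T : A T -> adj (pi T) = pi (adj T).
Proof.
move=> AT; have [_ _ pa] := pi_rep; apply: adjE; first by apply: image_bounded; exists T.
by apply: pa => //; [exact: Aadj|exact: adjP (Ab AT)].
Qed.

Lemma image_adj (T : H -> H) : M T -> M (adj T).
Proof. by move=> [S AS <-]; exists (adj S); [exact: Aadj|rewrite representation_adj]. Qed.

Lemma image_comp (S T : H -> H) : M S -> M T -> M (S \o T).
Proof.
move=> [S' AS <-] [T' AT <-]; have [_ pm _] := pi_rep.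
by exists (S' \o T'); [exact: Acomp|exact: pm].
Qed.

Lemma image_id : M id. Proof. by exists id. Qed.

Section compressed.
Variables (psi : (H -> H) -> R[i]) (hpsi : positive_functional psi) (psi1 : psi id = 1).
Local Notation L := (gns_space hpsi image_subspace image_bounded).
Local Notation theta := (compression hpsi image_subspace image_bounded).

Let pb T : A T -> @bounded_operators R H (pi T).
Proof. by move=> AT; apply: image_bounded; exists T. Qed.

Lemma compression_linear_map f : linear_map_on A f ->
  @linear_map_on R K L A (fun T => theta (f T)).
Proof.
move=> fl; have [fb _] := fl; split=> [T AT|c S T AS AT].
  by apply: compression_bounded; exact: fb.
rewrite (linear_map_onP c fl AS AT).
by apply: compressionP; exact: fb.
Qed.

Lemma compression_completely_positive f : completely_positive A f ->
  @completely_positive R K L A (fun T => theta (f T)).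
Proof.
move=> [fl fcp]; split; first exact: compression_linear_map.
move=> n a Aa apos; apply: compression_positive_mx; last exact: fcp.
by move=> i j; apply: fl.1.
Qed.

Lemma compression_representation : @star_representation R K L A (fun T => theta (pi T)).
Proof.
have [pl pm pa] := pi_rep; split; first exact: compression_linear_map.
  move=> S T AS AT; rewrite pm//; apply: compression_comp; first exact: pb.
    by exists T.
  by move=> X; apply: image_comp; [exists T|exact: (subspaceP X)].
move=> T T' AT AT' TT'; apply: compression_adjoint; first exact: pb.
exact: pa.
Qed.

Lemma compression_irreducible : pure_on psi image_subspace ->
  @irreducible_representation R K L A (fun T => theta (pi T)).
Proof.
move=> pure; split; first exact: compression_representation.
- exists id => //; rewrite pi_unital compression_id => id0.
  have := gns_dot hpsi image_bounded
    (in_subspace image_subspace image_id) (in_subspace image_subspace image_id).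
  rewrite [X in hdot _ X _](_ : _ = 0); last first.
    exact: (congr1 (fun F : L -> L => F _) id0).
  rewrite (psd0l (@hdot_psd R L)) /= adj_id psi1 => /eqP.
  by rewrite eq_sym oner_eq0.
- move=> N HN clN Ninv.
  apply: (pure_irreducible image_adj image_id psi1 pure HN clN) => X f Nf.
  have [T AT TX] := subspaceP X.
  by rewrite -TX; exact: Ninv.
Qed.

(** The two compressed maps agree by the unique extension property; the vector
    state of the cyclic vector turns this into an equality of values of
    [psi]. *)
Lemma pure_state_extension_eq (G : set (K -> K)) f :
  (forall s : (K -> K) -> (L -> L), irreducible_representation A s ->
    forall g, completely_positive A g -> (forall T, G T -> g T = s T) ->
    forall T, A T -> g T = s T) ->
  completely_positive A f -> (forall T, G T -> f T = pi T) ->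
  pure_on psi image_subspace -> forall T, A T -> psi (f T) = psi (pi T).
Proof.
move=> uep fcp fpi pure T AT.
have := uep _ (compression_irreducible pure) _ (compression_completely_positive fcp).
move=> /(_ _ T AT) E; have {}E : theta (f T) = theta (pi T).
  by apply: E => U GU; rewrite fpi.
pose xi : L := gns_vector hpsi image_subspace image_bounded
  (in_subspace image_subspace image_id).
have F (D : H -> H) : bounded_operators D -> hdot L (theta D xi) xi = psi D.
  by move=> bD; rewrite compression_form//= adj_id.
rewrite -(F _ (pb AT)) -E F//.
by have [[fb _] _] := fcp; exact: fb.
Qed.

End compressed.
End image.
End representations.

(** * Unperforated pairs *)

Theorem theorem1p3 (R : realType) (K : hilbertType R) (S : set (K -> K))
  (opS : operator_system S) (sepS : norm_separable S)
  (bdryS : forall (L : hilbertType R) (s : (K -> K) -> (L -> L)),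
    irreducible_representation (cstar_generated S) s ->
    boundary_representation S s)
  (H : hilbertType R) (pi : (K -> K) -> (H -> H))
  (pi_rep : star_representation (cstar_generated S) pi)
  (pi_unital : pi id = id)
  (Pi : (K -> K) -> (H -> H))
  (Pi_cp : completely_positive (cstar_generated S) Pi)
  (Pi_unital : Pi id = id)
  (Pi_ext : forall T, S T -> Pi T = pi T) :
  (unperforated ((Pi \- pi) @` cstar_generated S) (pi @` cstar_generated S) <->
   (forall T, cstar_generated S T -> Pi T = pi T)) /\
  (commuting_sets ((Pi \- pi) @` cstar_generated S)
     (pi @` cstar_generated S) ->
   unperforated ((Pi \- pi) @` cstar_generated S) (pi @` cstar_generated S) /\
   (forall T, cstar_generated S T -> Pi T = pi T)).
Proof.
have [Sb _ _ Sid] := opS.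
set A := cstar_generated S.
have Ab : A `<=` @bounded_operators R K by exact: cstar_generated_bounded.
have HA : is_subspace A by exact: cstar_generated_subspace.
have Acomp S1 T1 : A S1 -> A T1 -> A (S1 \o T1) by exact: cstar_generated_comp.
have Aadj T : A T -> A (adj T) by exact: cstar_generated_adj.
have Aid : A id by exact: cstar_generated_sub.
have [pil _ pia] := pi_rep; have [Pil _] := Pi_cp.
have kP := @hdot_psd R K; have hP := @hdot_psd R H.
have HM : is_subspace (pi @` A) by exact: (image_subspace HA pi_rep).
have Mb : pi @` A `<=` @bounded_operators R H by exact: (image_bounded pi_rep).
have Mid : (pi @` A) id by exact: (image_id Aid pi_unital).
have Madj := image_adj Ab Aadj pi_rep.
have eq_unperforated : (forall T, A T -> Pi T = pi T) ->
    unperforated ((Pi \- pi) @` A) (pi @` A).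
  move=> E a b [T AT <-] sa [U AU <-] sb ab.
  have a0 : (Pi \- pi) T = 0 by rewrite /= E// subrr.
  exists 0; rewrite a0; split.
  - by have [] := HM.
  - by move=> x y; rewrite (psd0l hP) (psd0r hP).
  - exact: lexx.
  - by move=> x; rewrite subr0 (psd0l hP).
  - by move: ab; rewrite a0.
have main : unperforated ((Pi \- pi) @` A) (pi @` A) \/
    commuting_sets ((Pi \- pi) @` A) (pi @` A) -> forall T, A T -> Pi T = pi T.
  move=> hyp; apply: (linear_maps_eq_selfadjoint HA Ab Aadj Pil pil) => a0 Aa0 sa0.
  apply: contrapT => Da0.
  (* Replacing [a0] by its opposite if needed, the norm of the difference is the
     supremum of its numerical range. *)
  have [a1 [Aa1 sa1 Da1 wN]] : exists a1, [/\ A a1, selfadjoint a1, Pi a1 <> pi a1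
      & numerical_sup (- (Pi a1 - pi a1)) <= numerical_sup (Pi a1 - pi a1)].
    have [le|lt] := leP (numerical_sup (- (Pi a0 - pi a0))) (numerical_sup (Pi a0 - pi a0)).
      by exists a0.
    exists (- a0); rewrite (linear_map_onN HA Pil Aa0) (linear_map_onN HA pil Aa0); split.
    - by have [A0 AL] := HA; rewrite -[- a0]addr0 -scaleN1r; exact: AL.
    - by move=> x y; rewrite !opNE (psdNl kP) (psdNr kP) sa0.
    - by move=> /oppr_inj.
    - by rewrite -opprD opprK ltW.
  have [x0 x0N0] : exists x : H, x != 0.
    apply: contrapT => no; apply: Da1; apply/funext => x.
    have all0 (y : H) : y = 0 by apply: contrapT => /eqP y0; apply: no; exists y.
    by rewrite (all0 (Pi a1 x)) (all0 (pi a1 x)).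
  pose a := Pi a1 - pi a1.
  have ba : bounded_operators a by apply: bounded_sub; [exact: Pil.1|exact: pil.1].
  have sa : selfadjoint a.
    have sPi := completely_positive_selfadjoint HA Ab Aid Pi_cp Aa1 sa1.
    have spi : selfadjoint (pi a1) by exact: pia.
    move=> x y; rewrite /a !opDE !opNE (psdBl hP) (psdBr hP).
    by rewrite sPi spi.
  have na : opnorm a <= numerical_sup a by exact: (selfadjoint_opnorm_numerical x0N0 ba sa wN).
  have wa : 0 < numerical_sup a.
    apply: (numerical_sup_gt0 x0N0 ba sa wN) => /eqP.
    by rewrite subr_eq0 => /eqP.
  have [psi [hpsi psi1 psi_le ext]] := peak_functional x0N0 (image_subspace HA pi_rep) Mb ba.
  have Va : ((Pi \- pi) @` A) a by exists a1.
  have pure : pure_on psi (image_subspace HA pi_rep).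
    move=> g1 g2 r g1l g2l r01 g1n g2n g12.
    have r01' : 0 < 1 - r < 1.
      by case/andP: r01 => r0 r1; rewrite subr_gt0 r1 ltrBlDr ltrDl.
    have g21 X : (1 - r) * g2 X + (1 - (1 - r)) * g1 X = Re (psi (val X)).
      by rewrite subKr addrC.
    apply: (ext g1 g2 r) => //; case: hyp => [unp|comm].
    - apply: (unperforated_peaks x0N0 Mb Madj Mid ba sa hpsi psi_le na _ g1l g2l r01 g1n g2n g12).
      by move=> b Mb' sb ab; exact: (unp a b).
    - apply: (commuting_peaks x0N0 Mb ba sa hpsi psi1 psi_le) => // X.
      by apply: comm => //; exact: (subspaceP X).
    - apply: (unperforated_peaks x0N0 Mb Madj Mid ba sa hpsi psi_le na _ g2l g1l r01' g2n g1n g21).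
      by move=> b Mb' sb ab; exact: (unp a b).
    - apply: (commuting_peaks x0N0 Mb ba sa hpsi psi1 psi_le) => // X.
      by apply: comm => //; exact: (subspaceP X).
  have psiE : psi (Pi a1) = psi (pi a1).
    apply: (pure_state_extension_eq Ab Acomp Aadj Aid pi_unital psi1 _ Pi_cp Pi_ext pure Aa1).
    by move=> s irr; have [_ uep] := bdryS _ _ irr; exact: uep.
  have := peak_functional_ge x0N0 ba hpsi psi_le.
  rewrite /a (functionalB hpsi (Pil.1 _ Aa1) (pil.1 _ Aa1)) psiE.
  by rewrite subrr /= leNgt wa.
split; first by split=> [unp|]; [apply: main; left|].
by move=> comm; have E := main (or_intror comm); split => //; exact: eq_unperforated.
Qed.
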